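(* Let $q$ be one of the norms $\|\cdot\|_1$, $\|\cdot\|$ (Euclidean), $\|\cdot\|_\infty$ on $\mathbb{R}^{n_1}$, and let $\sigma>0$. Let $(\bar y,\bar u,\bar v)\in\mathbb{R}^{n_1}\times\mathbb{R}^{n_2}\times\mathbb{R}^{n_1}$ be a solution of the KKT system $$A^{T}u+D^{T}v=0,\quad Ay-b\in\partial h^{*}(u),\quad Dy\in\partial q^{*}(v).$$ Then the dual nondegeneracy condition at $(\bar u,\bar v)$, $$A^{T}\,\mathrm{lin}\,\mathcal{T}_{C_1}(\bar u)+D^{T}\,\mathrm{lin}\,\mathcal{T}_{C_2}(\bar v)=\mathbb{R}^{n_1},$$ holds if and only if $\hat\partial^{2}\varphi(\bar y)$ is nonsingular, i.e. every matrix in the set $$\hat\partial^{2}\varphi(\bar y)=\sigma A^{T}\,\partial\mathrm{Prox}_{\sigma h^{*}}\big(\sigma(A\bar y-b)+\bar u\big)\,A+\sigma D^{T}\,\partial\mathrm{Prox}_{\sigma q^{*}}\big(\sigma D\bar y+\bar v\big)\,D$$ is nonsingular.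
   Context: Setting. Let $n\ge 3$ be an integer, $n_1=n(n-1)/2$, $n_2=n(n-1)(n-2)/2$. For a real symmetric $n\times n$ matrix $X=(x_{ij})$ put $\mathrm{trivec}(X)=[x_{12},x_{13},x_{23},\ldots,x_{1n},\ldots,x_{n-1,n}]^T\in\mathbb{R}^{n_1}$. $A\in\mathbb{R}^{n_2\times n_1}$ is the triangle inequality matrix: for each $1\le i<j<k\le n$ it has three rows, for which the corresponding components of $A\,\mathrm{trivec}(X)$ are $x_{ij}-x_{ik}-x_{jk}$, $x_{ik}-x_{ij}-x_{jk}$ and $x_{jk}-x_{ij}-x_{ik}$. $\widetilde X$ is a given nonnegative symmetric zero-diagonal matrix, $b=-A\,\mathrm{trivec}(\widetilde X)$, and $D=\mathrm{diag}(\mathrm{trivec}(W))$ for a given symmetric weight matrix $W$, all diagonal entries of $D$ being positive. $h=\delta_{C}$ is the indicator function of $C=\mathbb{R}^{n_2}_-$. The primal problem is $\min_{y\in\mathbb{R}^{n_1}}\{h(Ay-b)+q(Dy)\}$. $f^*$ denotes the convex conjugate and $\partial f$ the convex subdifferential of a convex function $f$. One has $h^*=\delta_{C_1}$ with $C_1=\mathbb{R}^{n_2}_+$ and $q^*=\delta_{C_2}$, where $C_2$ is the closed unit ball of the norm dual to $q$ (the unit ball of $\|\cdot\|_\infty$, $\|\cdot\|$, $\|\cdot\|_1$ for $q=\|\cdot\|_1,\|\cdot\|,\|\cdot\|_\infty$ respectively). $\mathcal{T}_S(x)$ is the tangent cone of the convex set $S$ at $x\in S$, and $\mathrm{lin}\,K=K\cap(-K)$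 for a convex cone $K$. $\mathrm{Prox}_{\sigma f}(x)=\mathrm{argmin}_u\{f(u)+\frac1{2\sigma}\|u-x\|^2\}$; in particular $\mathrm{Prox}_{\sigma h^*}=\Pi_{C_1}$ and $\mathrm{Prox}_{\sigma q^*}=\Pi_{C_2}$ are Euclidean projections. For a Lipschitz map $G$, $\partial G(x)$ denotes its Clarke generalized Jacobian at $x$. The set $\hat\partial^2\varphi(\bar y)$ consists of all matrices $\sigma A^TUA+\sigma D^TVD$ with $U\in\partial\mathrm{Prox}_{\sigma h^*}(\sigma(A\bar y-b)+\bar u)$ and $V\in\partial\mathrm{Prox}_{\sigma q^*}(\sigma D\bar y+\bar v)$; here $\varphi(y)=\mathcal{L}_\sigma(y;\bar u,\bar v)$ is the augmented Lagrangian of the primal problem with multipliers $(\bar u,\bar v)$, whose gradient is $\nabla\varphi(y)=A^T\mathrm{Prox}_{\sigma h^*}(\sigma(Ay-b)+\bar u)+D^T\mathrm{Prox}_{\sigma q^*}(\sigma Dy+\bar v)$. *)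

(* Defs.v *)
From HB Require Import structures.
From mathcomp Require Import all_boot all_order all_algebra.
From mathcomp Require Import all_classical all_reals all_analysis.

Set Implicit Arguments.
Unset Strict Implicit.
Unset Printing Implicit Defensive.

Import Order.TTheory GRing.Theory Num.Theory.
Import numFieldNormedType.Exports.

Local Open Scope classical_set_scope.
Local Open Scope ring_scope.

Definition dim1 (n : nat) : nat := (n * (n - 1) %/ 2)%N.
Definition dim2 (n : nat) : nat := (n * (n - 1) * (n - 2) %/ 2)%N.

(* With 0-based indices: (0,1), (0,2), (1,2), (0,3), ..., (n-2,n-1). *)
Definition pairs (n : nat) : seq ('I_n * 'I_n) :=
  [seq (i, j) | j : 'I_n <- enum 'I_n, i <- [seq i : 'I_n <- enum 'I_n | (i < j)%N]].

Definition triples (n : nat) : seq ('I_n * 'I_n * 'I_n) :=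
  [seq t : 'I_n * 'I_n * 'I_n <- enum {: 'I_n * 'I_n * 'I_n} | (t.1.1 < t.1.2 < t.2)%N].

(* (p, p1, p2) stands for the inequality x_p - x_p1 - x_p2 <= 0. *)
Definition triangle_rows (n : nat) :
    seq (('I_n * 'I_n) * ('I_n * 'I_n) * ('I_n * 'I_n)) :=
  flatten [seq let: (i, j, k) := t in
               [:: ((i, j), (i, k), (j, k));
                   ((i, k), (i, j), (j, k));
                   ((j, k), (i, j), (i, k))]
          | t <- triples n].

Lemma size_pairs (n : nat) : size (pairs n) == dim1 n.
Proof.
rewrite /pairs size_allpairs_dep sumnE big_map big_enum /=.
under eq_bigr => j _.
  rewrite size_filter.
  have -> : count (fun i : 'I_n => (i < j)%N) (enum 'I_n) = j.
    rewrite -(count_map val (fun i => (i < j)%N)) val_enum_ord -size_filter.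
    have -> : [seq i <- iota 0 n | (i < j)%N] = iota 0 j.
      have -> : iota 0 n = iota 0 j ++ iota j (n - j).
        by rewrite -{2}(add0n j) -iotaD subnKC // ltnW.
      rewrite filter_cat.
      rewrite (_ : seq.filter _ (iota 0 j) = iota 0 j); last first.
        by apply/all_filterP/allP => i; rewrite mem_iota.
      rewrite (_ : seq.filter _ _ = [::]) ?cats0//.
      apply/eqP; rewrite -(negbK (_ == _)) -has_filter.
      apply/hasPn => i; rewrite mem_iota => /andP[ji _].
      by rewrite -leqNgt.
    by rewrite size_iota.
  over.
rewrite /dim1 subn1 divn2 -bin2 -bin2_sum big_mkord.
exact/eqP/eq_bigl.
Qed.

Lemma size_triples (n : nat) : size (triples n) = 'C(n, 3).
Proof.
rewrite -(card_ltn_sorted_tuples 3 n) /triples.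
pose f (t : 'I_n * 'I_n * 'I_n) : 3.-tuple 'I_n := [tuple t.1.1; t.1.2; t.2].
have f_inj : injective f.
  by move=> [[a b] c] [[a' b'] c'] /(congr1 val) [-> -> ->].
rewrite -(size_map f) cardE; apply/perm_size/uniq_perm.
- by rewrite map_inj_uniq // filter_uniq // enum_uniq.
- exact: enum_uniq.
move=> t; rewrite mem_enum inE; apply/mapP/idP => [[[[a b] c]]|].
  by rewrite mem_filter /= => /andP[/andP[ab bc] _] ->; rewrite /= ab bc.
case/tupleP: t => a t; case/tupleP: t => b t; case/tupleP: t => c t.
rewrite (tuple0 t) /= => /andP[ab /andP[bc _]].
exists (a, b, c); first by rewrite mem_filter /= ab bc mem_enum.
exact/val_inj.
Qed.

Lemma size_triangle_rows (n : nat) : size (triangle_rows n) == dim2 n.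
Proof.
rewrite /triangle_rows size_flatten /shape -map_comp sumnE big_map.
rewrite (eq_bigr (fun=> 3%N)); last by move=> [[i j] k] _.
rewrite big_const_seq count_predT iter_addn_0 size_triples /dim2.
have E : (n * (n - 1) * (n - 2) = 3 * 'C(n, 3) * 2)%N.
  have := bin_ffact n 3; rewrite /= !ffactnS ffactn0 muln1.
  rewrite (_ : 3`! = 6)%N // -!subn1 -subnDA => E.
  by rewrite -mulnA -E (mulnC 3) -mulnA.
by rewrite E mulnK // mulnC.
Qed.

Definition pair_of (n : nat) (c : 'I_(dim1 n)) : 'I_n * 'I_n :=
  tnth (Tuple (size_pairs n)) c.

Definition triangle_row (n : nat) (r : 'I_(dim2 n)) :
    ('I_n * 'I_n) * ('I_n * 'I_n) * ('I_n * 'I_n) :=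
  tnth (Tuple (size_triangle_rows n)) r.

Definition trivec (R : realType) (n : nat) (X : 'M[R]_n) : 'cV[R]_(dim1 n) :=
  \col_c X (pair_of c).1 (pair_of c).2.

Definition triangle_mx (R : realType) (n : nat) : 'M[R]_(dim2 n, dim1 n) :=
  \matrix_(r, c) let: (p, p1, p2) := triangle_row r in
    (pair_of c == p)%:R - (pair_of c == p1)%:R - (pair_of c == p2)%:R.

Lemma mem_pairs (n : nat) (p : 'I_n * 'I_n) : (p \in pairs n) = (p.1 < p.2)%N.
Proof.
apply/allpairsPdep/idP => [[j [i [_]]]|lt_p].
  by rewrite mem_filter => /andP[ij _] ->.
exists p.2, p.1; split; last by case: p lt_p.
  exact: mem_enum.
by rewrite mem_filter lt_p mem_enum.
Qed.

Lemma uniq_pairs (n : nat) : uniq (pairs n).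
Proof.
apply: allpairs_uniq_dep; first exact: enum_uniq.
  by move=> j _; rewrite filter_uniq // enum_uniq.
by move=> [j i] [j' i'] _ _ /= [-> ->].
Qed.

Lemma triangle_mxE (R : realType) (n : nat) (X : 'M[R]_n) (r : 'I_(dim2 n)) :
  (triangle_mx R n *m trivec X) r 0 =
  let: (p, p1, p2) := triangle_row r in X p.1 p.2 - X p1.1 p1.2 - X p2.1 p2.2.
Proof.
have sumE (p : 'I_n * 'I_n) : (p.1 < p.2)%N ->
    \sum_(c < dim1 n) (pair_of c == p)%:R * trivec X c 0 = X p.1 p.2.
  rewrite -mem_pairs => /(tnthP (Tuple (size_pairs n)) p)[c ->].
  rewrite (bigD1 c) //= eqxx mul1r mxE big1 ?addr0 // => c' c'c.
  rewrite (_ : _ == _ = false) ?mul0r //; apply/negbTE/negP.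
  have /tuple_uniqP inj : uniq (Tuple (size_pairs n)) := uniq_pairs n.
  by move=> /eqP /inj /eqP; rewrite (negbTE c'c).
have : triangle_row r \in triangle_rows n by exact: mem_tnth.
rewrite mxE; under eq_bigr do rewrite mxE.
case: (triangle_row r) => -[p p1] p2.
case/flattenP => s /mapP[[[i j] k]].
rewrite mem_filter /= => /andP[/andP[ij jk] _] -> /=.
have ik := ltn_trans ij jk.
under eq_bigr do rewrite !mulrBl.
by rewrite !sumrB !inE => /or3P[] /eqP[-> -> ->]; rewrite !sumE.
Qed.

Section ConvexAnalysis.
Context {R : realType} {m : nat}.
Implicit Types (x y u v d : 'cV[R]_m) (S K : set 'cV[R]_m).
Implicit Types (f : 'cV[R]_m -> \bar R).

Definition dot u v : R := \sum_i u i 0 * v i 0.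

Definition norm1 x : R := \sum_i `|x i 0|.
Definition norm2 x : R := Num.sqrt (\sum_i x i 0 ^+ 2).
(* The norm of the library on matrices is the maximum norm. *)
Definition norm_inf x : R := `|x|.

Definition dual_norm (q : 'cV[R]_m -> R) v : R :=
  sup [set dot v x | x in [set x | q x <= 1]].

Definition indic_fun S x : \bar R := if `[< S x >] then 0%E else +oo%E.

Definition conjugate f u : \bar R :=
  ereal_sup (range (fun x => ((dot u x)%:E - f x)%E)).

Definition subdiff f x : set 'cV[R]_m :=
  [set g | forall z, (f x + (dot g (z - x))%:E <= f z)%E].

(* [get] returns the minimizer, which exists and is unique when f is proper,
   closed and convex. *)
Definition prox (sigma : R) f x : 'cV[R]_m :=
  get [set u | forall w,
    (f u + (norm2 (u - x) ^+ 2 / (2 * sigma))%:E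
     <= f w + (norm2 (w - x) ^+ 2 / (2 * sigma))%:E)%E].

Definition tangent_cone S x : set 'cV[R]_m :=
  [set d | exists (t : nat -> R) (z : nat -> 'cV[R]_m),
    [/\ forall k, 0 < t k, t @ \oo --> 0, forall k, S (z k),
        z @ \oo --> x
      & (fun k => (t k)^-1 *: (z k - x)) @ \oo --> d]].

Definition lineality K : set 'cV[R]_m := K `&` [set d | K (- d)].

End ConvexAnalysis.

Section Clarke.
Context {R : realType} {m p : nat}.
Implicit Types (G : 'cV[R]_m -> 'cV[R]_p) (x : 'cV[R]_m).

(* Column-vector convention, 'd G x d = jacobian_cV G x *m d; the library's
   [jacobian] is for row vectors. *)
Definition jacobian_cV G x : 'M[R]_(p, m) :=
  \matrix_(i, j) ('d G x (delta_mx j 0)) i 0.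

Definition limiting_jacobian G x : set 'M[R]_(p, m) :=
  [set J | exists z : nat -> 'cV[R]_m,
    [/\ forall k, differentiable G (z k), z @ \oo --> x
      & (fun k => jacobian_cV G (z k)) @ \oo --> J]].

Definition convex_hull (S : set 'M[R]_(p, m)) : set 'M[R]_(p, m) :=
  [set M | exists (k : nat) (w : 'I_k -> R) (J : 'I_k -> 'M[R]_(p, m)),
    [/\ forall i, 0 <= w i, \sum_i w i = 1, forall i, S (J i)
      & M = \sum_i w i *: J i]].

Definition clarke_jacobian G x : set 'M[R]_(p, m) :=
  convex_hull (limiting_jacobian G x).

End Clarke.

Section Problem.
Context {R : realType} {n : nat}.

Definition rhs (Xt : 'M[R]_n) : 'cV[R]_(dim2 n) :=
  - (triangle_mx R n *m trivec Xt).

Definition weight_mx (W : 'M[R]_n) : 'M[R]_(dim1 n) := diag_mx (trivec W)^T.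

Definition nonpos_orthant : set 'cV[R]_(dim2 n) :=
  [set u | forall i, u i 0 <= 0].

Definition hfun : 'cV[R]_(dim2 n) -> \bar R := indic_fun nonpos_orthant.
Definition hstar : 'cV[R]_(dim2 n) -> \bar R := conjugate hfun.
Definition C1 : set 'cV[R]_(dim2 n) := [set u | forall i, 0 <= u i 0].

Context (q : 'cV[R]_(dim1 n) -> R).

Definition qstar : 'cV[R]_(dim1 n) -> \bar R := conjugate (EFin \o q).
Definition C2 : set 'cV[R]_(dim1 n) := [set v | dual_norm q v <= 1].

Definition KKT (Xt W : 'M[R]_n) (y : 'cV[R]_(dim1 n))
    (u : 'cV[R]_(dim2 n)) (v : 'cV[R]_(dim1 n)) : Prop :=
  let A := triangle_mx R n in
  let D := weight_mx W in
  [/\ A^T *m u + D^T *m v = 0,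
      subdiff hstar u (A *m y - rhs Xt)
    & subdiff qstar v (D *m y)].

Definition dual_nondegenerate (W : 'M[R]_n)
    (u : 'cV[R]_(dim2 n)) (v : 'cV[R]_(dim1 n)) : Prop :=
  let A := triangle_mx R n in
  let D := weight_mx W in
  [set A^T *m d + D^T *m e
    | d in lineality (tangent_cone C1 u) & e in lineality (tangent_cone C2 v)]
  = [set: 'cV[R]_(dim1 n)].

Definition gen_hessian (sigma : R) (Xt W : 'M[R]_n) (y : 'cV[R]_(dim1 n))
    (u : 'cV[R]_(dim2 n)) (v : 'cV[R]_(dim1 n)) : set 'M[R]_(dim1 n) :=
  let A := triangle_mx R n in
  let D := weight_mx W in
  [set sigma *: (A^T *m U *m A) + sigma *: (D^T *m V *m D)
    | U in clarke_jacobian (prox sigma hstar)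
             (sigma *: (A *m y - rhs Xt) + u)
    & V in clarke_jacobian (prox sigma qstar) (sigma *: (D *m y) + v)].

End Problem.

(* Main.v *)
Require Import Defs.
From HB Require Import structures.
From mathcomp Require Import all_boot all_order all_algebra.
From mathcomp Require Import all_classical all_reals all_analysis.
From mathcomp Require Import ring lra.

Set Implicit Arguments.
Unset Strict Implicit.
Unset Printing Implicit Defensive.

Import Order.TTheory GRing.Theory Num.Theory.
Import numFieldNormedType.Exports.

Local Open Scope classical_set_scope.
Local Open Scope ring_scope.

(* [Prox_{sigma h*}] and [Prox_{sigma q*}] are the projections onto [C1] and
   [C2]; write [P] for one of them, [S] for the set, [x] for the point and
   [v = P x]. Every [V] in the Clarke Jacobian of [P] at [x] satisfies
   [|V w|^2 <= <V w, w>], and every [w] in [lin T_S(v)] is an eigenvector of [V]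
   with positive eigenvalue; hence [ker V] is orthogonal to [lin T_S(v)].
   Moreover some [V0] in the Clarke Jacobian has its range in [lin T_S(v)].
   If [M z = 0] with [M = sigma A^T U A + sigma D^T V D], then [U A z = 0] and
   [V D z = 0], so [z] is orthogonal to
   [A^T lin T_C1(u) + D^T lin T_C2(v)]; conversely, writing [z = M0 t] for the
   [M0] built from the two special elements exhibits [z] in that sum.
   The orthant, the cube and the cross-polytope are treated together as
   polyhedra; the Euclidean ball needs a direct computation. *)

(** * Inner product and Euclidean norm of column vectors *)

Section DotProduct.
Context {R : realType}.

Lemma dotE m (u v : 'cV[R]_m) : dot u v = (u^T *m v) 0 0.
Proof. by rewrite mxE; apply: eq_bigr => i _; rewrite mxE. Qed.

Lemma dotC m (u v : 'cV[R]_m) : dot u v = dot v u.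
Proof. by apply: eq_bigr => i _; rewrite mulrC. Qed.

Lemma dotDr m (u v w : 'cV[R]_m) : dot u (v + w) = dot u v + dot u w.
Proof. by rewrite !dotE mulmxDr mxE. Qed.

Lemma dotNr m (u v : 'cV[R]_m) : dot u (- v) = - dot u v.
Proof. by rewrite !dotE mulmxN mxE. Qed.

Lemma dotZr m a (u v : 'cV[R]_m) : dot u (a *: v) = a * dot u v.
Proof. by rewrite !dotE -scalemxAr mxE. Qed.

Lemma dot0r m (u : 'cV[R]_m) : dot u 0 = 0.
Proof. by rewrite dotE mulmx0 mxE. Qed.

Lemma dotDl m (u v w : 'cV[R]_m) : dot (u + v) w = dot u w + dot v w.
Proof. by rewrite dotC dotDr !(dotC w). Qed.

Lemma dotNl m (u v : 'cV[R]_m) : dot (- u) v = - dot u v.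
Proof. by rewrite dotC dotNr dotC. Qed.

Lemma dotZl m a (u v : 'cV[R]_m) : dot (a *: u) v = a * dot u v.
Proof. by rewrite dotC dotZr dotC. Qed.

Lemma dot0l m (u : 'cV[R]_m) : dot 0 u = 0.
Proof. by rewrite dotC dot0r. Qed.

Definition dot_linE :=
  (@dotDr, @dotDl, @dotNr, @dotNl, @dotZr, @dotZl, @dot0r, @dot0l).

Lemma dot_mulmx m p (M : 'M[R]_(m, p)) u v :
  dot (M *m u) v = dot u (M^T *m v).
Proof. by rewrite !dotE trmx_mul mulmxA. Qed.

Lemma dot_trmulmx m p (M : 'M[R]_(p, m)) u v :
  dot (M^T *m u) v = dot u (M *m v).
Proof. by rewrite dot_mulmx trmxK. Qed.

Lemma dot_ge0 m (u : 'cV[R]_m) : 0 <= dot u u.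
Proof. by apply: sumr_ge0 => i _; rewrite -expr2 sqr_ge0. Qed.

Lemma dot_eq0 m (u : 'cV[R]_m) : dot u u = 0 -> u = 0.
Proof.
move=> u0; apply/matrixP => i j; rewrite ord1 mxE.
have : dot u u == 0 by rewrite u0.
rewrite psumr_eq0 => [/allP/(_ i)|k _]; last by rewrite -expr2 sqr_ge0.
by rewrite mem_index_enum mulf_eq0 orbb => /(_ isT)/eqP.
Qed.

Lemma sqr_coord_le_dot m (u : 'cV[R]_m) i : u i 0 ^+ 2 <= dot u u.
Proof.
rewrite /dot (bigD1 i) //= expr2 lerDl.
by apply: sumr_ge0 => j _; rewrite -expr2 sqr_ge0.
Qed.

Lemma norm2E m (u : 'cV[R]_m) : norm2 u = Num.sqrt (dot u u).
Proof. by congr Num.sqrt; apply: eq_bigr => i _; rewrite expr2. Qed.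

Lemma norm2_ge0 m (u : 'cV[R]_m) : 0 <= norm2 u.
Proof. exact: sqrtr_ge0. Qed.

Lemma norm2_sqr m (u : 'cV[R]_m) : norm2 u ^+ 2 = dot u u.
Proof. by rewrite norm2E sqr_sqrtr // dot_ge0. Qed.

Lemma norm2_le1 m (u : 'cV[R]_m) : (norm2 u <= 1) = (dot u u <= 1).
Proof. by rewrite -norm2_sqr expr_le1 // norm2_ge0. Qed.

End DotProduct.

(** * Entrywise limits of matrices *)

Section Limits.
Context {R : realType} {T : Type} {F : set_system T} {FF : Filter F}.

Lemma cvg_mx_coord m p (f : T -> 'M[R]_(m, p)) (M : 'M[R]_(m, p)) :
  (forall i j, f x i j @[x --> F] --> M i j) -> f @ F --> M.
Proof.
move=> fM; apply/cvg_ballP => e e0.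
have : \forall x \near F, forall i j, ball (M i j) e (f x i j).
  apply: filter_forall => i; apply: filter_forall => j.
  by have /cvg_ballP := fM i j; apply.
by apply: filterS => x; split.
Qed.

Lemma mx_coord_cvg m p (f : T -> 'M[R]_(m, p)) (M : 'M[R]_(m, p)) i j :
  f @ F --> M -> f x i j @[x --> F] --> M i j.
Proof.
move=> fM; exact: (cvg_comp _ (fun N : 'M[R]_(m, p) => N i j) fM
  (@coord_continuous _ _ _ i j M)).
Qed.

Lemma cvg_mulmx m p r (f : T -> 'M[R]_(m, p)) (g : T -> 'M[R]_(p, r))
    (M : 'M[R]_(m, p)) (N : 'M[R]_(p, r)) :
  f @ F --> M -> g @ F --> N -> f x *m g x @[x --> F] --> M *m N.
Proof.
move=> fM gN; apply: cvg_mx_coord => i j; rewrite mxE.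
under eq_cvg do rewrite mxE.
apply: (@cvg_big _ _ +%R 0 predT) => //; first exact: add_continuous.
by move=> k _; apply: cvgM; apply: mx_coord_cvg.
Qed.

Lemma cvg_dot m (f g : T -> 'cV[R]_m) (a b : 'cV[R]_m) :
  f @ F --> a -> g @ F --> b -> dot (f x) (g x) @[x --> F] --> dot a b.
Proof.
move=> fa gb; apply: (@cvg_big _ _ +%R 0 predT) => //.
  exact: add_continuous.
by move=> k _; apply: cvgM; apply: mx_coord_cvg.
Qed.

End Limits.

(** * Projections onto closed convex sets *)

Section Projection.
Context {R : realType} {m : nat}.
Implicit Types (S : set 'cV[R]_m) (x p : 'cV[R]_m).

(** The obtuse-angle inequality stands in for distance minimization: it is affine in [c], so its
    instances can be added and translated. *)
Definition is_proj S x p := S p /\ forall c, S c -> dot (x - p) (c - p) <= 0.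

Definition convex_set_cV S :=
  forall a b (t : R), 0 <= t <= 1 -> S a -> S b -> S (b + t *: (a - b)).

(** Test each of the two obtuse-angle inequalities at the other projection and add. *)
Lemma is_proj_firm S x p x' p' : is_proj S x p -> is_proj S x' p' ->
  dot (p - p') (p - p') <= dot (p - p') (x - x').
Proof.
move=> [Sp xp] [Sp' xp']; have := xp _ Sp'; have := xp' _ Sp.
have -> : x - x' = (x - p) - (x' - p') + (p - p').
  by apply/matrixP => i j; rewrite !mxE; ring.
rewrite -(opprB p p'); move: (p - p') (x - p) (x' - p') => d a a'.
by rewrite !dot_linE !(dotC _ d); lra.
Qed.

Lemma is_proj_uniq S x p p' : is_proj S x p -> is_proj S x p' -> p = p'.
Proof.
move=> xp xp'; apply/eqP; rewrite -subr_eq0; apply/eqP/dot_eq0/le_anti.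
by rewrite dot_ge0 (le_trans (is_proj_firm xp xp')) // subrr dot0r.
Qed.

Lemma is_proj_nonexp S x p x' p' : is_proj S x p -> is_proj S x' p' ->
  dot (p - p') (p - p') <= dot (x - x') (x - x').
Proof.
move=> xp xp'; have := is_proj_firm xp xp'.
have := dot_ge0 (p - p' - (x - x')).
move: (p - p') (x - x') => d e; rewrite !dot_linE (dotC e d); lra.
Qed.

Lemma dist_min_is_proj S x p : convex_set_cV S -> S p ->
  (forall c, S c -> dot (p - x) (p - x) <= dot (c - x) (c - x)) ->
  is_proj S x p.
Proof.
move=> Scvx Sp pmin; split=> // c Sc; rewrite leNgt; apply/negP => pc.
set e := c - p in pc.
have e_gt0 : 0 < dot e e.
  rewrite lt_def dot_ge0 andbT; apply/eqP => /dot_eq0 e0.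
  by rewrite e0 dot0r ltxx in pc.
have le2 (t : R) : 0 <= t <= 1 -> 2 * t * dot (x - p) e <= t ^+ 2 * dot e e.
  move=> t01; have := pmin _ (Scvx _ _ _ t01 Sc Sp); rewrite -/e.
  have -> : p + t *: e - x = t *: e - (x - p) by rewrite opprB addrCA addrA.
  rewrite -(opprB x p); move: (x - p) (e) => d f.
  by rewrite !dot_linE (dotC f d); lra.
(* Along the segment from [p] to [c] the distance to [x] is least at [t = dot (x - p) e / dot e e],
   or at [t = 1] if this ratio exceeds 1; either choice contradicts [le2]. *)
have [dle|dge] := lerP (dot (x - p) e) (dot e e).
  have t01 : 0 <= dot (x - p) e / dot e e <= 1.
    by rewrite divr_ge0 ?(ltW pc) ?(ltW e_gt0) //= ler_pdivrMr // mul1r.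
  have := le2 _ t01; rewrite exprMn -!mulrA (mulrA _ _ (dot e e)).
  rewrite [X in _ <= X](_ : _ = dot (x - p) e * (dot (x - p) e / dot e e)).
    have : 0 < dot (x - p) e * ((dot e e)^-1 * dot (x - p) e).
      by rewrite !mulr_gt0 // invr_gt0.
    by rewrite mulrC (mulrC _^-1); lra.
  by field; rewrite gt_eqF.
have := le2 1; rewrite lexx ler01 => /(_ isT); lra.
Qed.

Lemma is_proj_exists S x : closed S -> convex_set_cV S -> S !=set0 ->
  exists p, is_proj S x p.
Proof.
move=> Scl Scvx [c0 Sc0].
pose dist (c : 'cV[R]_m) := dot (c - x) (c - x).
(* Only points at least as close to [x] as [c0] compete, and these form a compact set; row vectors
   are the form that [EVT_min_rV] takes. *)
pose K := [set r : 'rV[R]_m | S r^T /\ dist r^T <= dist c0].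
have trc : continuous (fun r : 'rV[R]_m => r^T).
  move=> r; apply: (cvg_mx_coord (FF := nbhs_filter r)) => i j; rewrite mxE.
  by under eq_cvg do rewrite mxE; exact: coord_continuous.
have distc : continuous (fun r : 'rV[R]_m => dist r^T).
  move=> r; apply: (cvg_dot (FF := nbhs_filter r));
    by apply: cvgB; [exact: trc|exact: cvg_cst].
have Kcl : closed K.
  apply: closedI; first exact: (preimage_closed (in1W trc)).
  apply: (@preimage_closed _ _ _ [set t : R | t <= dist c0]) => [r _|].
    exact: distc.
  exact: closed_le.
have Kbd : bounded_set K.
  exists (Num.sqrt (dist c0) + `|x|); split; first exact: num_real.
  move=> M /ltW MB r [_ rd]; apply: le_trans MB.
  rewrite [leLHS]/Num.norm /= mx_normrE.
  apply/bigmax_leP; split=> [|[i j] _ /=].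
    by rewrite addr_ge0 ?sqrtr_ge0 // -[X in 0 <= X]/(`|x|).
  have -> : r i j = (r^T - x) j 0 + x j 0 by rewrite ord1 !mxE subrK.
  apply: le_trans (ler_normD _ _) _; apply: lerD.
    rewrite -sqrtr_sqr ler_wsqrtr //; apply: le_trans rd.
    exact: sqr_coord_le_dot.
  rewrite [leRHS]/Num.norm /= mx_normrE.
  by apply/bigmax_geP; right; exists (j, 0).
have K0 : K !=set0 by exists c0^T; rewrite /K /= trmxK.
have [r rK rmin] := EVT_min_rV K0 (bounded_closed_compact Kbd Kcl)
  (continuous_subspaceT distc).
move: rK; rewrite inE => -[Sr rd].
exists r^T; apply: dist_min_is_proj => // c Sc.
have [cd|/ltW cd] := lerP (dist c) (dist c0); last exact: le_trans rd cd.
by have := rmin c^T; rewrite !inE /K /= !trmxK; apply.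
Qed.

(** [get] is meaningful only once a minimizer is exhibited, and the projection is one. Whatever
    minimizer [get] picks lies in [S], since its value is at most the finite value at [p], and hence
    is the projection. *)
Lemma prox_indic S (sigma : R) x : 0 < sigma ->
  closed S -> convex_set_cV S -> S !=set0 ->
  is_proj S x (prox sigma (indic_fun S) x).
Proof.
move=> s0 Scl Scvx S0; have [p [Sp xp]] := is_proj_exists x Scl Scvx S0.
rewrite /prox; set Q := [set u | _].
have Qp : Q p.
  move=> w; rewrite /indic_fun; case: asboolP => // _; case: asboolP => // Sw.
    rewrite !add0e lee_fin ler_pM2r ?invr_gt0 ?mulr_gt0 // !norm2_sqr.
    have := xp _ Sw; have := dot_ge0 (w - p).
    have -> : w - x = (w - p) - (x - p) by rewrite opprB addrA subrK.
    rewrite -(opprB x p); move: (x - p) (w - p) => d e.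
    by rewrite !dot_linE (dotC e d); lra.
  by rewrite add0e addye // leey.
have {Qp} : Q (get Q) by apply: getI Qp.
move: (get Q) => r Qr; have Sr : S r.
  have := Qr p; rewrite /indic_fun; case: asboolP => // _.
  by case: asboolP => // _; rewrite add0e addye.
apply: dist_min_is_proj => // c Sc; have := Qr c.
rewrite /indic_fun; case: asboolP => // _; case: asboolP => // _.
by rewrite !add0e lee_fin ler_pM2r ?invr_gt0 ?mulr_gt0 // !norm2_sqr.
Qed.

End Projection.

(** * Local differentiability, and Jacobians evaluated along one direction *)

Lemma near_eq_differentiable (R : realType) (V W : normedModType R)
    (f g : V -> W) z :
  (\forall y \near z, f y = g y) -> differentiable f z -> differentiable g z.
Proof.
move=> fg df; have fgz : f z = g z := nbhs_singleton fg.
have fg0 : \forall h \near (0 : V), (f \o shift z) h = (g \o shift z) h.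
  by move: fg; rewrite (near_shift 0) /=; apply: filterS => h /=; rewrite subr0.
have gE : g \o shift z = cst (g z) + 'd f z +o_ 0 id.
  apply/eqaddoP => e e0; have /eqaddoP/(_ e e0) := diff_locally df.
  move: fg0; apply: filterS2 => h /= fgh.
  by rewrite !fctE /= -fgz fgh.
have dg : 'd g z = 'd f z :> (_ -> _).
  by apply: diff_unique => //; exact: diff_continuous.
apply/diff_locallyP; rewrite dg; split=> //; exact: diff_continuous.
Qed.

Section Jacobian.
Context {R : realType} {m p : nat}.
Implicit Types (G : 'cV[R]_m -> 'cV[R]_p) (w x z : 'cV[R]_m).

Lemma jacobian_cV_mulmx G z w : jacobian_cV G z *m w = 'd G z w.
Proof.
rewrite [in RHS](_ : w = \sum_j w j 0 *: delta_mx j 0); last first.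
  by rewrite [LHS]matrix_sum_delta; apply: eq_bigr => j _; rewrite big_ord1.
rewrite linear_sum; apply/matrixP => i k; rewrite ord1 mxE summxE.
by apply: eq_bigr => j _; rewrite linearZ !mxE mulrC.
Qed.

Lemma diff_quotient_cvg G z w : differentiable G z ->
  h^-1 *: (G (h *: w + z) - G z) @[h --> 0^'] --> jacobian_cV G z *m w.
Proof.
move=> dG; rewrite jacobian_cV_mulmx -deriveE //.
by have := @diff_derivable _ _ _ G z w dG; rewrite /derivable /derive.
Qed.

Lemma jacobian_cV_dir G z w (e : 'cV[R]_p) : differentiable G z ->
  h^-1 *: (G (h *: w + z) - G z) @[h --> 0^'] --> e ->
  jacobian_cV G z *m w = e.
Proof. by move=> dG; have := @diff_quotient_cvg G z w dG; exact: cvg_unique. Qed.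

(** Only the restriction of [G] to the line through [z] in direction [w] matters; there the
    difference quotient is eventually constant. *)
Lemma jacobian_cV_affine_dir G z w e : differentiable G z ->
  (\forall h \near 0, G (h *: w + z) = G z + h *: e) ->
  jacobian_cV G z *m w = e.
Proof.
move=> dG Gaff; apply: jacobian_cV_dir => //.
apply: cvg_near_cst; near=> h.
have -> : G (h *: w + z) = G z + h *: e.
  by near: h; apply: cvg_within.
rewrite addrC addKr scalerA mulVf ?scale1r //.
by near: h; exact: nbhs_dnbhs_neq.
Unshelve. all: by end_near. Qed.

End Jacobian.

(** * Clarke Jacobians of a projection *)

Section ClarkeProjection.
Context {R : realType} {m : nat}.
Implicit Types (S L : set 'cV[R]_m) (P : 'cV[R]_m -> 'cV[R]_m).
Implicit Types (V J : 'M[R]_m) (w x z : 'cV[R]_m).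

(** The infinitesimal form of firm nonexpansiveness; it does the work of symmetry and positive
    semidefiniteness of [V] in what follows. *)
Definition firm_mx V := forall w, dot (V *m w) (V *m w) <= dot (V *m w) w.

(** Divide the inequality of [is_proj_firm] between [h *: w + z] and [z] by [h ^+ 2] and let [h]
    tend to 0. *)
Lemma jacobian_proj_firm S P z : (forall x, is_proj S x (P x)) ->
  differentiable P z -> firm_mx (jacobian_cV P z).
Proof.
move=> projP dP w; have qw := diff_quotient_cvg dP.
apply: ler_cvg_to (cvg_dot (qw w) (qw w)) (cvg_dot (qw w) (cvg_cst w)) _.
near=> h; have h0 : h != 0 by near: h; exact: nbhs_dnbhs_neq.
have := is_proj_firm (projP (h *: w + z)) (projP z).
rewrite addrK; move: (P _ - P z) => d; rewrite !dot_linE => dd.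
rewrite -[X in _ <= _ * X](mulKf h0) [leLHS]mulrA [leRHS]mulrA -expr2.
by rewrite ler_wpM2l ?sqr_ge0.
Unshelve. all: by end_near. Qed.

Lemma clarke_proj_firm S P x V : (forall x, is_proj S x (P x)) ->
  clarke_jacobian P x V -> firm_mx V.
Proof.
move=> projP [k [a [J [a0 a1 limJ ->]]]] w.
have firmJ i : firm_mx (J i).
  move=> {}w; have [z [dz _ zJ]] := limJ i.
  have zJw : jacobian_cV P (z k') *m w @[k' --> \oo] --> J i *m w.
    by apply: cvg_mulmx zJ _; exact: cvg_cst.
  apply: ler_cvg_to (cvg_dot zJw zJw) (cvg_dot zJw (cvg_cst w)) _.
  by apply: nearW => k'; apply: jacobian_proj_firm projP (dz k') _.
rewrite mulmx_suml; set b := \sum_i _.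
have bE u : dot b u = \sum_i a i * dot (J i *m w) u.
  rewrite /b; elim/big_ind2: _ => [|u1 r1 u2 r2 <- <-|i _]; first exact: dot0l.
    exact: dotDl.
  by rewrite -scalemxAl dotZl.
(* Variance argument: the weights sum to 1, so the mean of [|J i w - b|^2] is the mean of
   [|J i w|^2] minus [|b|^2]. Hence [|b|^2] is at most the mean of [|J i w|^2], itself at most
   [dot b w]. *)
have : 0 <= \sum_i a i * dot (J i *m w - b) (J i *m w - b).
  by apply: sumr_ge0 => i _; rewrite mulr_ge0 // dot_ge0.
have : \sum_i a i * dot (J i *m w) (J i *m w) <= dot b w.
  by rewrite bE; apply: ler_sum => i _; rewrite ler_wpM2l //; exact: firmJ.
have -> : \sum_i a i * dot (J i *m w - b) (J i *m w - b) =
    \sum_i a i * dot (J i *m w) (J i *m w) - dot b b.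
  transitivity (\sum_i (a i * dot (J i *m w) (J i *m w) -
      (2 * (a i * dot (J i *m w) b) - a i * dot b b))).
    by apply: eq_bigr => i _; rewrite !dot_linE (dotC b (J i *m w)); ring.
  rewrite !sumrB -mulr_sumr -bE -mulr_suml a1 mul1r; congr (_ - _); ring.
lra.
Qed.

Lemma clarke_jacobian_eigen P x w (c : R) :
  (forall J, limiting_jacobian P x J -> J *m w = c *: w) ->
  forall V, clarke_jacobian P x V -> V *m w = c *: w.
Proof.
move=> limc V [k [a [J [_ a1 limJ ->]]]].
rewrite mulmx_suml -[in RHS](mul1r c) -a1 mulr_suml scaler_suml.
by apply: eq_bigr => i _; rewrite -scalemxAl limc // scalerA.
Qed.

Lemma limiting_clarke P x J : limiting_jacobian P x J -> clarke_jacobian P x J.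
Proof.
move=> limJ; exists 1%N, (fun=> 1), (fun=> J); split=> //.
  by rewrite big_ord1.
by rewrite big_ord1 scale1r.
Qed.

(** Firmness at [w + t *: z] reads [c * dot w w <= dot w w + t * dot w z] after division by [c]; it
    can hold for all real [t] only if [dot w z] vanishes. *)
Lemma firm_mx_ker V w z (c : R) : firm_mx V -> 0 < c -> V *m w = c *: w ->
  V *m z = 0 -> dot w z = 0.
Proof.
move=> firmV c0 Vw Vz; apply/eqP/negPn/negP => wz.
(* This [t] makes the right-hand side equal to [c * dot w w - 1]. *)
have [t tE] : exists t, t * dot w z = c * dot w w - dot w w - 1.
  by exists ((c * dot w w - dot w w - 1) / dot w z); rewrite divfK.
have := firmV (w + t *: z).
rewrite mulmxDr -scalemxAr Vz scaler0 addr0 Vw !dot_linE (mulrCA t) tE.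
by rewrite -mulrDr ler_pM2l //; lra.
Qed.

(* [L] plays the role of [lin T_S(v)], with [v] the projection of [x]. *)
Definition clarke_spans P x L :=
  [/\ forall V, clarke_jacobian P x V -> firm_mx V,
      forall V w, clarke_jacobian P x V -> L w ->
        exists2 c, 0 < c & V *m w = c *: w
    & exists2 V, clarke_jacobian P x V & forall w, L (V *m w)].

End ClarkeProjection.

(** * Spanning versus nonsingularity, as linear algebra *)

Section Nondegeneracy.
Context {R : realType}.

Lemma not_unitmx_ker m (M : 'M[R]_m) :
  M \notin unitmx -> exists2 z : 'cV[R]_m, z != 0 & M *m z = 0.
Proof.
rewrite -unitmx_tr -row_free_unit -kermx_eq0 => /rowV0Pn[z /sub_kermxP zM z0].
exists z^T; first by rewrite trmx_eq0.
by rewrite -[M]trmxK -trmx_mul zM trmx0.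
Qed.

Lemma spans_iff_nonsingular m k l (A : 'M[R]_(k, m)) (D : 'M[R]_(l, m)) s
    (P : 'cV[R]_k -> 'cV[R]_k) (Q : 'cV[R]_l -> 'cV[R]_l) x x' L L' : 0 < s ->
  clarke_spans P x L -> clarke_spans Q x' L' ->
  [set A^T *m d + D^T *m e | d in L & e in L'] = [set: 'cV[R]_m] <->
  forall M, [set s *: (A^T *m U *m A) + s *: (D^T *m V *m D)
      | U in clarke_jacobian P x & V in clarke_jacobian Q x'] M ->
    M \in unitmx.
Proof.
move=> s0 [firmP eigP [U0 PU0 U0L]] [firmQ eigQ [V0 QV0 V0L]]; split.
  move=> spanT _ [U PU [V QV <-]]; apply: contraT => /not_unitmx_ker[z z0].
  rewrite mulmxDl -!scalemxAl -scalerDr => /eqP; rewrite scaler_eq0 gt_eqF //=.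
  (* Pairing [M z = 0] with [z] gives [dot (U A z) (A z) + dot (V D z) (D z) = 0]. By firmness the
     two terms dominate [|U A z|^2] and [|V D z|^2], so both images vanish. *)
  rewrite -!mulmxA => /eqP/(congr1 (dot z)).
  rewrite dot0r dotDr -!(dotC (_^T *m _)) !dot_trmulmx => UV0.
  have fU := firmP _ PU (A *m z); have fV := firmQ _ QV (D *m z).
  have Uz : U *m (A *m z) = 0.
    by apply: dot_eq0; have := dot_ge0 (U *m (A *m z));
       have := dot_ge0 (V *m (D *m z)); lra.
  have Vz : V *m (D *m z) = 0.
    by apply: dot_eq0; have := dot_ge0 (U *m (A *m z));
       have := dot_ge0 (V *m (D *m z)); lra.
  have : [set: 'cV[R]_m] z by [].
  rewrite -spanT => -[d Ld [e Le zE]].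
  have [c c0 Ud] := eigP _ _ PU Ld; have [c' c'0 Ve] := eigQ _ _ QV Le.
  suff /dot_eq0 z_eq0 : dot z z = 0 by rewrite z_eq0 eqxx in z0.
  rewrite -{1}zE dotDl !dot_trmulmx.
  rewrite (firm_mx_ker (firmP _ PU) c0 Ud Uz).
  by rewrite (firm_mx_ker (firmQ _ QV) c'0 Ve Vz) addr0.
move=> nonsing; apply/seteqP; split=> // z _.
set M := s *: (A^T *m U0 *m A) + s *: (D^T *m V0 *m D).
have Mu : M \in unitmx by apply: nonsing; exists U0 => //; exists V0.
(* The factor [s] turns [A^T U0 A + D^T V0 D] into [M], so that applying this sum to [t] returns
   [z]. *)
pose t := s *: (invmx M *m z).
exists (U0 *m (A *m t)); first exact: U0L.
exists (V0 *m (D *m t)); first exact: V0L.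
rewrite !mulmxA -mulmxDl /t -scalemxAr scalemxAl scalerDr -/M mulmxA mulmxV //.
exact: mul1mx.
Qed.

End Nondegeneracy.

(** * Tangent cones: feasible directions and normals *)

Section TangentCone.
Context {R : realType} {m : nat}.
Implicit Types (S : set 'cV[R]_m) (v d : 'cV[R]_m).

Lemma cvg_line {T : Type} {F : set_system T} {FF : Filter F} (t : T -> R)
    v d : t @ F --> 0 -> v + t x *: d @[x --> F] --> v.
Proof.
move=> t0; rewrite -[X in _ --> X]addr0 -(scale0r d).
by apply: cvgD; [exact: cvg_cst|exact: cvgZr_tmp].
Qed.

Lemma tangent_cone_dir S v d :
  (\forall t \near 0, S (v + t *: d)) -> tangent_cone S v d.
Proof.
(* [tangent_cone] asks every term of the sequence to lie in [S], not just almost all; hence the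
   shift by [N]. *)
move=> Svd; have [N _ SN] : \forall k \near \oo, S (v + harmonic k *: d).
  by have /(_ _ Svd) := @cvg_harmonic R.
have t0 : (fun k => harmonic (k + N)%N : R) @ \oo --> 0.
  by rewrite (cvg_shiftn N (@harmonic R)); exact: cvg_harmonic.
exists (fun k => harmonic (k + N)), (fun k => v + harmonic (k + N) *: d).
split=> [k||k||]; first exact: harmonic_gt0.
- exact: t0.
- by apply: SN; rewrite /= leq_addl.
- exact: cvg_line.
- apply: cvg_near_cst; apply: nearW => k.
  by rewrite [v + _]addrC addrK scalerA mulVf ?scale1r // gt_eqF // harmonic_gt0.
Qed.

(** All quotients [(z k - v) / t k] lie in the closed half-space with outward normal [n], hence so
    does their limit. *)
Lemma tangent_cone_dot_le0 S v d n : (forall c, S c -> dot n (c - v) <= 0) ->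
  tangent_cone S v d -> dot n d <= 0.
Proof.
move=> Sn [t [z [t0 _ Sz _ zd]]].
have ndc : dot n ((t k)^-1 *: (z k - v)) @[k --> \oo] --> dot n d.
  by apply: cvg_dot zd; exact: cvg_cst.
apply: (cvgr_to_le ndc); apply: nearW => k.
by rewrite dotZr pmulr_rle0 ?invr_gt0 // Sn.
Qed.

End TangentCone.

(** * Polyhedra and the lineality of their tangent cones *)

Section Polyhedron.
Context {R : realType} {m p : nat} (a : 'M[R]_(p, m)) (b : 'cV[R]_p).
Implicit Types (v w x z c : 'cV[R]_m).

Definition polyhedron : set 'cV[R]_m := [set x | forall j, (a *m x) j 0 <= b j 0].

Definition active v (j : 'I_p) := (a *m v) j 0 == b j 0.

(** Inactive rows are zeroed rather than deleted, which keeps the dimensions fixed; the kernel is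
    the common null space of the active constraints. *)
Definition active_mx v : 'M[R]_(p, m) :=
  \matrix_(j, i) ((active v j)%:R * a j i).

Lemma active_mxE v w j : (active_mx v *m w) j 0 = (active v j)%:R * (a *m w) j 0.
Proof.
by rewrite !mxE mulr_sumr; apply: eq_bigr => i _; rewrite !mxE mulrA.
Qed.

Lemma active_mx_eq0 v w j : active_mx v *m w = 0 -> active v j ->
  (a *m w) j 0 = 0.
Proof. by move=> Bw vj; have := active_mxE v w j; rewrite Bw vj mxE mul1r. Qed.

Lemma convex_polyhedron : convex_set_cV polyhedron.
Proof.
move=> x y t /andP[t0 t1] xC yC j; have := xC j; have := yC j.
rewrite mulmxDr -scalemxAr mulmxBr; move: (a *m x) (a *m y) => ax ay.
by rewrite !mxE; nra.
Qed.

Lemma closed_polyhedron : closed polyhedron.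
Proof.
have -> : polyhedron = \bigcap_(j in [set: 'I_p]) [set x | (a *m x) j 0 <= b j 0].
  by apply/seteqP; split=> [x xC j _ //|x xC j]; exact: (xC j).
apply: closed_bigI => j _.
apply: (@preimage_closed _ _ (fun x => (a *m x) j 0) [set t | t <= b j 0]).
  move=> x _; apply: (mx_coord_cvg (f := fun y => a *m y) (M := a *m x)).
  apply: (cvg_mulmx (FF := nbhs_filter x)).
    exact: cvg_cst.
  exact: cvg_id.
exact: closed_le.
Qed.

(** Constraints active at [v] are constant along [w], the others have slack at [x]. The base point
    [x] may differ from [v], as is needed for projections of points near a given one. *)
Lemma near_polyhedron v w x : active_mx v *m w = 0 -> polyhedron x ->
  (forall j, ~~ active v j -> (a *m x) j 0 < b j 0) ->
  \forall t \near (0 : R), polyhedron (x + t *: w).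
Proof.
move=> Bw xC xlt.
apply: (filter_forall (F := nbhs (0 : R))
  (f := fun j t => (a *m (x + t *: w)) j 0 <= b j 0)) => j.
have [vj|vj] := boolP (active v j).
  apply: nearW => t; rewrite mulmxDr -scalemxAr.
  have := xC j; have := active_mx_eq0 Bw vj; move: (a *m w) (a *m x) => aw ax aw0.
  by rewrite !mxE aw0 mulr0 addr0.
have axt : (a *m (x + t *: w)) j 0 @[t --> (0 : R)] --> (a *m x) j 0.
  apply: mx_coord_cvg; apply: cvg_mulmx; first exact: cvg_cst.
  by apply: cvg_line; exact: cvg_id.
have := @cvgr_lt _ _ _ (nbhs_filter (0 : R)) _ _ axt _ (xlt j vj).
by apply: filterS => t /ltW.
Qed.

Lemma inactive_lt v j : polyhedron v -> ~~ active v j -> (a *m v) j 0 < b j 0.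
Proof. by move=> vC; rewrite lt_neqAle vC andbT. Qed.

(** Each active row is an outward normal at [v]; if both [w] and [- w] are tangent, its product with
    [w] is both nonpositive and nonnegative. *)
Lemma lineality_polyhedron v : polyhedron v ->
  lineality (tangent_cone polyhedron v) = [set w | active_mx v *m w = 0].
Proof.
move=> vC; apply/seteqP; split=> [w [Tw TNw]|w /= Bw]; last first.
  have BNw : active_mx v *m - w = 0 by rewrite mulmxN Bw oppr0.
  split; apply: tangent_cone_dir; apply: (near_polyhedron (v := v)).
  - exact: Bw.
  - exact: vC.
  - by move=> j; exact: inactive_lt.
  - exact: BNw.
  - exact: vC.
  - by move=> j; exact: inactive_lt.
apply/matrixP => j i; rewrite ord1 active_mxE [RHS]mxE.
have [vj|_] := boolP (active v j); last by rewrite mul0r.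
have rowE c : dot (row j a)^T c = (a *m c) j 0.
  by rewrite dotE trmxK -row_mul mxE.
have nC c : polyhedron c -> dot (row j a)^T (c - v) <= 0.
  by move=> cC; rewrite dotDr dotNr !rowE (eqP vj) subr_le0.
have := tangent_cone_dot_le0 nC Tw; have := tangent_cone_dot_le0 nC TNw.
by rewrite dotNr rowE oppr_le0 mul1r => w0 w0'; apply/le_anti/andP.
Qed.

Lemma normal_dot0 v w n : polyhedron v -> active_mx v *m w = 0 ->
  (forall c, polyhedron c -> dot n (c - v) <= 0) -> dot n w = 0.
Proof.
move=> vC Bw nC.
have lin : lineality (tangent_cone polyhedron v) w.
  by rewrite lineality_polyhedron.
case: lin => /(tangent_cone_dot_le0 nC) + /(tangent_cone_dot_le0 nC).
by rewrite dotNr oppr_le0 => *; apply/le_anti/andP.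
Qed.

End Polyhedron.

(** * Projection onto a polyhedron: directions fixed by all limiting Jacobians *)

Section PolyhedronProjection.
Context {R : realType} {m p : nat} (a : 'M[R]_(p, m)) (b : 'cV[R]_p).
Implicit Types (v w x z c : 'cV[R]_m).
Local Notation C := (polyhedron a b).
Local Notation active_mx := (active_mx a b).

Lemma proj_cvg (S : set 'cV[R]_m) P x : (forall x, is_proj S x (P x)) ->
  P z @[z --> x] --> P x.
Proof.
move=> projP; apply: (cvg_mx_coord (FF := nbhs_filter x)) => i j; rewrite ord1.
have dist0 : Num.sqrt (dot (z - x) (z - x)) @[z --> x] --> (0 : R).
  rewrite -[X in _ --> X](_ : Num.sqrt (dot (x - x) (x - x)) = 0); last first.
    by rewrite subrr dot0r sqrtr0.
  have zx : z - x @[z --> x] --> x - x.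
    apply: (@cvgB _ _ _ (nbhs x) _ (fun z => z) (fun=> x)); first exact: cvg_id.
    exact: cvg_cst.
  have dx : dot (z - x) (z - x) @[z --> x] --> dot (x - x) (x - x).
    exact: (cvg_dot (FF := nbhs_filter x)).
  exact: (cvg_comp _ Num.sqrt dx (@sqrt_continuous R _)).
apply/cvgrPdist_le => e e0.
have /cvgrPdist_le/(_ e e0) := dist0; apply: filterS => z.
rewrite sub0r normrN ger0_norm ?sqrtr_ge0 //; apply: le_trans.
rewrite distrC -sqrtr_sqr ler_wsqrtr //.
apply: le_trans (is_proj_nonexp (projP z) (projP x)).
by apply: le_trans (sqr_coord_le_dot _ i); rewrite !mxE.
Qed.

(** For small [t] both [q + t *: w] and [q - t *: w] are feasible, so [z - q] is orthogonal to
    [t *: w]; translating [z] and [q] together keeps this residual and its obtuse-angle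
    inequality. *)
Lemma is_proj_shift v w z q : active_mx v *m w = 0 -> is_proj C z q ->
  (forall j, ~~ active a b v j -> (a *m q) j 0 < b j 0) ->
  \forall t \near (0 : R), is_proj C (t *: w + z) (q + t *: w).
Proof.
move=> Bw [qC zq] qlt.
have BNw : active_mx v *m - w = 0 by rewrite mulmxN Bw oppr0.
have := near_polyhedron Bw qC qlt; have := near_polyhedron BNw qC qlt.
apply: filterS2 => t qNtw qtw; split=> // c cC.
have tw0 : t * dot (z - q) w = 0.
  have := zq _ qtw; have := zq _ qNtw.
  by rewrite !(addrC q) !addrK !dotZr dotNr; lra.
have -> : t *: w + z - (q + t *: w) = z - q.
  by rewrite opprD (addrC (- q)) addrACA subrr add0r.
by rewrite opprD addrA dotDr dotNr dotZr tw0 subr0 zq.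
Qed.

Context (P : 'cV[R]_m -> 'cV[R]_m) (projP : forall x, is_proj C x (P x)).

(** By continuity of [P], constraints inactive at [P x] stay inactive at [P (z k)] for large [k].
    Then [is_proj_shift] makes [P] a translation along [w] near [z k], so each Jacobian there fixes
    [w]. *)
Lemma limiting_polyhedron_fix x w J : active_mx (P x) *m w = 0 ->
  limiting_jacobian P x J -> J *m w = 1 *: w.
Proof.
move=> Bw [z [dz zx zJ]]; rewrite scale1r.
have zJw : jacobian_cV P (z k) *m w @[k --> \oo] --> J *m w.
  by apply: cvg_mulmx zJ _; exact: cvg_cst.
suff zw : jacobian_cV P (z k) *m w @[k --> \oo] --> w by apply: cvg_unique zJw zw.
apply: cvg_near_cst.
have near_lt : \forall y \near x, forall j, ~~ active a b (P x) j ->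
    (a *m P y) j 0 < b j 0.
  apply: (filter_forall (F := nbhs x)
    (f := fun j y => ~~ active a b (P x) j -> (a *m P y) j 0 < b j 0)) => j.
  have [_|xj] := boolP (active a b (P x) j); first by apply: (@filterE _ (nbhs x)).
  have aP : (a *m P y) j 0 @[y --> x] --> (a *m P x) j 0.
    apply: (mx_coord_cvg (f := fun y => a *m P y) (M := a *m P x)).
    by apply: (cvg_mulmx (FF := nbhs_filter x)); [exact: cvg_cst|exact: proj_cvg].
  have [xC _] := projP x.
  have := @cvgr_lt _ _ _ (nbhs_filter x) _ _ aP _ (inactive_lt xC xj).
  by apply: filterS.
have : \forall k \near \oo, forall j, ~~ active a b (P x) j ->
    (a *m P (z k)) j 0 < b j 0 := zx _ near_lt.
apply: filterS => k zlt.
apply: jacobian_cV_affine_dir; first exact: dz.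
have := is_proj_shift Bw (projP (z k)) zlt; apply: filterS => t.
exact: is_proj_uniq.
Qed.

End PolyhedronProjection.

(** [B] and [B *m B^T] have the same column space: if [B B^T N = 0], each column of [B^T N] has
    squared norm 0. This yields the orthogonal projector onto [ker B] for [B] of any rank. *)
Lemma gram_factor (R : realType) m p (B : 'M[R]_(p, m)) :
  exists G, B = B *m B^T *m G.
Proof.
suff /submxP[G BG] : (B^T <= B *m B^T)%MS.
  by exists G^T; rewrite -[LHS]trmxK [in LHS]BG !trmx_mul trmxK.
rewrite submxE; set N := cokermx _.
have BN : B *m (B^T *m N) = 0 by rewrite mulmxA mulmx_coker.
apply/eqP/matrixP => i j.
have /dot_eq0/matrixP/(_ i 0) : dot (col j (B^T *m N)) (col j (B^T *m N)) = 0.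
  by rewrite !colE -mulmxA dot_trmulmx (mulmxA B^T) mulmxA BN mul0mx dot0r.
by rewrite !mxE.
Qed.

Lemma mulmx_cV_inj (R : realType) m p (A B : 'M[R]_(m, p)) :
  (forall w : 'cV[R]_p, A *m w = B *m w) -> A = B.
Proof.
move=> AB; apply/matrixP => i j.
by have /matrixP/(_ i 0) := AB (delta_mx j 0); rewrite -!colE !mxE.
Qed.

Lemma differentiable_affine (R : realType) m p (M : 'M[R]_(p, m)) (c : 'cV[R]_p)
    (z : 'cV[R]_m) :
  differentiable (fun y => c + M *m y) z.
Proof.
apply: (@differentiableD _ _ _ (cst c) (mulmx M : 'cV[R]_m -> 'cV[R]_p)).
  exact: differentiable_cst.
apply: linear_differentiable => y; apply: (cvg_mulmx (FF := nbhs_filter y)).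
  exact: cvg_cst.
exact: cvg_id.
Qed.

Lemma near_affine_jacobian (R : realType) m p (G : 'cV[R]_m -> 'cV[R]_p) z
    (M : 'M[R]_(p, m)) (c : 'cV[R]_p) :
  (\forall y \near z, c + M *m y = G y) ->
  differentiable G z /\ jacobian_cV G z = M.
Proof.
move=> near_aff.
have dG : differentiable G z.
  exact: near_eq_differentiable near_aff (differentiable_affine _ _ _).
split=> //; apply: mulmx_cV_inj => w; apply: jacobian_cV_affine_dir => //.
have zw : h *: w + z @[h --> (0 : R)] --> z.
  under eq_cvg do rewrite addrC; apply: cvg_line; exact: cvg_id.
have : \forall h \near (0 : R), c + M *m (h *: w + z) = G (h *: w + z) :=
  zw _ near_aff.
apply: filterS => h <-; rewrite -(nbhs_singleton near_aff).
by rewrite mulmxDr -scalemxAr addrCA addrC.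
Qed.

(** * A limiting Jacobian with range in the lineality space, for polyhedra *)

Section PolyhedronJacobian.
Context {R : realType} {m p : nat} (a : 'M[R]_(p, m)) (b : 'cV[R]_p).
Local Notation C := (polyhedron a b).
Context (P : 'cV[R]_m -> 'cV[R]_m) (projP : forall x, is_proj C x (P x)).
Context (x : 'cV[R]_m).
Local Notation v := (P x).
Local Notation B := (active_mx a b v).

(* Moving [x] into the relative interior of [v + N_C(v)] makes the projection
   affine nearby; its linear part is the orthogonal projector onto [ker B]. *)
Lemma polyhedron_limiting_jacobian :
  exists2 M, limiting_jacobian P x M & forall w : 'cV[R]_m, B *m (M *m w) = 0.
Proof.
have [vC xv] := projP x.
have [G BG] := gram_factor B; pose M := 1%:M - B^T *m G.
have BM : B *m M = 0 by rewrite mulmxBr mulmx1 mulmxA -BG subrr.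
exists M; last by move=> w; rewrite mulmxA BM mul0mx.
(* [M] kills everything orthogonal to [ker B]: for [w = M n] in [ker B], [dot w w] equals [dot n w]
   minus a term paired with [B w = 0]. *)
have M0 n : (forall w, B *m w = 0 -> dot n w = 0) -> M *m n = 0.
  move=> nB; apply: dot_eq0; set w := M *m n.
  have Bw : B *m w = 0 by rewrite mulmxA BM mul0mx.
  rewrite {1}/w mulmxBl mul1mx dotDl dotNl nB // -mulmxA dot_trmulmx Bw dot0r.
  by rewrite subr0.
have Mxv : M *m (x - v) = 0 by apply: M0 => w Bw; exact: normal_dot0 vC Bw xv.
have MB (c : 'cV[R]_p) : M *m (B^T *m c) = 0.
  by apply: M0 => w Bw; rewrite dot_trmulmx Bw dot0r.
(* [B^T *m const_mx 1] is the sum of the active normals, so [x] is moved by giving each active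
   constraint the extra multiplier [harmonic k > 0]. *)
pose z k := x + harmonic k *: (B^T *m const_mx 1).
have zv k : z k - v = B^T *m (G *m (z k - v)).
  apply/eqP; rewrite -subr_eq0 mulmxA -{1}(mul1mx (z k - v)) -mulmxBl -/M.
  by rewrite /z addrAC mulmxDr Mxv -scalemxAr MB scaler0 addr0.
have near_proj k : \forall y \near z k, is_proj C y (v + M *m (y - z k)).
  have yzk : y - z k @[y --> z k] --> (0 : 'cV[R]_m).
    rewrite -(subrr (z k)).
    apply: (@cvgB _ _ _ (nbhs (z k)) _ (fun y => y) (fun=> z k)).
      exact: cvg_id.
    exact: cvg_cst.
  have near_lt : \forall y \near z k, forall j, ~~ active a b v j ->
      (a *m (v + M *m (y - z k))) j 0 < b j 0.
    apply: (filter_forall (F := nbhs (z k)) (f := fun j y => ~~ active a b v j ->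
      (a *m (v + M *m (y - z k))) j 0 < b j 0)) => j.
    have [_|vj] := boolP (active a b v j); first by apply: (@filterE _ (nbhs (z k))).
    have ay : (a *m (v + M *m (y - z k))) j 0 @[y --> z k] --> (a *m v) j 0.
      apply: (mx_coord_cvg (f := fun y => a *m (v + M *m (y - z k))) (M := a *m v)).
      apply: (cvg_mulmx (FF := nbhs_filter (z k))); first exact: cvg_cst.
      rewrite -[X in _ --> X]addr0 -(mulmx0 _ M).
      apply: (@cvgD _ _ _ (nbhs (z k)) _ (fun=> v) (fun y => M *m (y - z k))).
        exact: cvg_cst.
      by apply: (cvg_mulmx (FF := nbhs_filter (z k))) => //; exact: cvg_cst.
    have := @cvgr_lt _ _ _ (nbhs_filter (z k)) _ _ ay _ (inactive_lt vC vj).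
    by apply: filterS.
  (* The multiplier of constraint [j] at [y] is perturbed by [(G *m (y - z k)) j 0]; near [z k] it
     stays nonnegative. *)
  have near_pos : \forall y \near z k, forall j,
      0 <= harmonic k + (G *m (y - z k)) j 0.
    apply: (filter_forall (F := nbhs (z k)) (f := fun j y =>
      0 <= harmonic k + (G *m (y - z k)) j 0)) => j.
    have Gy : (G *m (y - z k)) j 0 @[y --> z k] --> (0 : R).
      rewrite -[X in _ --> X](_ : (G *m (0 : 'cV[R]_m)) j 0 = 0); last first.
        by rewrite mulmx0 mxE.
      apply: (mx_coord_cvg (f := fun y => G *m (y - z k)) (M := G *m 0)).
      by apply: (cvg_mulmx (FF := nbhs_filter (z k))) => //; exact: cvg_cst.
    have h0 : - harmonic k < (0 : R) by rewrite oppr_lt0 harmonic_gt0.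
    have := @cvgr_gt _ _ _ (nbhs_filter (z k)) _ _ Gy _ h0.
    by apply: filterS => y /ltW; lra.
  move: near_lt near_pos; apply: filterS2 => y ylt ypos.
  have Bw : B *m (M *m (y - z k)) = 0 by rewrite mulmxA BM mul0mx.
  split=> [j|c cC].
    have [vj|/ylt/ltW //] := boolP (active a b v j).
    have := vC j; have := active_mx_eq0 Bw vj; rewrite (mulmxDr a).
    by move: (a *m (M *m _)) (a *m v) => aw av aw0; rewrite mxE aw0 addr0.
  (* The residual is the normal [x - v] plus a nonnegative combination of active normals, hence
     normal at [v]. It is also orthogonal to [M *m (y - z k)], so the inequality transfers to the
     shifted point. *)
  have -> : y - (v + M *m (y - z k)) = (x - v) +
      B^T *m (harmonic k *: const_mx 1 + G *m (y - z k)).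
    have := subrK (z k) y; move: (y - z k) => e <-.
    rewrite (mulmxDr B^T) -scalemxAr mulmxBl mul1mx -mulmxA /z.
    move: (B^T *m (G *m e)) (_ *: (B^T *m _)) => s t.
    by apply/matrixP => i j; rewrite !mxE; ring.
  rewrite (opprD v) (addrA c) (dotDr _ (c - v)) dotNr.
  rewrite [dot _ (M *m _)](_ : _ = 0) ?subr0; last first.
    by rewrite (dotDl (x - v)) (normal_dot0 vC Bw xv) dot_trmulmx Bw dot0r addr0.
  rewrite (dotDl (x - v)); have := xv _ cC.
  suff : dot (B^T *m (harmonic k *: const_mx 1 + G *m (y - z k))) (c - v) <= 0.
    by move: (dot _ _) (dot _ _) => r s; lra.
  rewrite dot_trmulmx; apply: sumr_le0 => j _.
  rewrite mulr_ge0_le0 //.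
    by have := ypos j; move: (G *m _) => Gy; rewrite !mxE mulr1.
  rewrite active_mxE; have [vj|_] := boolP (active a b v j); last by rewrite mul0r.
  rewrite mul1r mulmxBr; have := cC j; rewrite -(eqP vj).
  by move: (a *m c) (a *m v) => ac av; rewrite !mxE subr_le0.
have Jk k : differentiable P (z k) /\ jacobian_cV P (z k) = M.
  apply: (near_affine_jacobian (c := v - M *m z k)).
  have := near_proj k; apply: filterS => y /is_proj_uniq/(_ (projP y)) <-.
  by rewrite mulmxBr addrA addrAC.
exists z; split=> [k||].
- by have [] := Jk k.
- by apply: cvg_line; exact: cvg_harmonic.
- by apply: cvg_near_cst; apply: nearW => k; have [] := Jk k.
Qed.

Lemma clarke_spans_polyhedron : clarke_spans P x (lineality (tangent_cone C v)).
Proof.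
have [vC _] := projP x; rewrite lineality_polyhedron //; split.
- by move=> V; exact: clarke_proj_firm.
- move=> V w cV Bw; exists 1; first exact: ltr01.
  by apply: clarke_jacobian_eigen cV => J; exact: limiting_polyhedron_fix.
- have [M limM BM] := polyhedron_limiting_jacobian.
  by exists M => //; exact: limiting_clarke.
Qed.

End PolyhedronJacobian.

(** * Projection onto the Euclidean unit ball *)

Section EuclideanBall.
Context {R : realType} {m : nat}.
Implicit Types (v w x z c : 'cV[R]_m).

Definition ball2 : set 'cV[R]_m := [set x | dot x x <= 1].

Lemma dot_ball2_le1 v c : ball2 v -> ball2 c -> dot v c <= 1.
Proof.
move=> v1 c1; have := dot_ge0 (v - c); rewrite !dot_linE (dotC c v).
by have : dot v v <= 1 by []; have : dot c c <= 1 by []; lra.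
Qed.

Lemma convex_ball2 : convex_set_cV ball2.
Proof.
move=> x y t /andP[t0 t1] Sx Sy; have xy := dot_ball2_le1 Sx Sy.
move: Sx Sy; rewrite /ball2 /= !dot_linE (dotC y x) => xx yy.
have h1 : 0 <= t ^+ 2 * (1 - dot x x) by rewrite mulr_ge0 ?sqr_ge0 ?subr_ge0.
have h2 : 0 <= (1 - t) ^+ 2 * (1 - dot y y).
  by rewrite mulr_ge0 ?sqr_ge0 ?subr_ge0.
have h3 : 0 <= t * (1 - t) * (1 - dot x y) by rewrite !mulr_ge0 ?subr_ge0.
by lra.
Qed.

Lemma closed_ball2 : closed ball2.
Proof.
apply: (@preimage_closed _ _ (fun x => dot x x) [set t | t <= 1]).
  move=> x _; apply: (cvg_dot (FF := nbhs_filter x)); exact: cvg_id.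
exact: closed_le.
Qed.

(** This is the maximum of 1 and the norm of [z], so division by it gives the projection both inside
    and outside the ball. *)
Definition scale2 z : R := Num.sqrt (Num.max 1 (dot z z)).

Lemma scale2_sqr z : scale2 z ^+ 2 = Num.max 1 (dot z z).
Proof. by rewrite sqr_sqrtr // le_max ler01. Qed.

Lemma scale2_ge1 z : 1 <= scale2 z.
Proof. by rewrite -[leLHS]sqrtr1 ler_wsqrtr // le_max lexx. Qed.

Lemma scale2_gt0 z : 0 < scale2 z.
Proof. exact: lt_le_trans (scale2_ge1 z). Qed.

Lemma is_proj_ray v (s : R) : dot v v = 1 -> 1 <= s ->
  is_proj ball2 (s *: v) v.
Proof.
move=> v1 s1; have Sv : ball2 v by rewrite /ball2 /= v1.
split=> // c Sc; rewrite -[X in _ - X]scale1r -scalerBl dotZl dotDr dotNr v1.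
by rewrite mulr_ge0_le0 ?subr_ge0 // subr_le0 dot_ball2_le1.
Qed.

Lemma is_proj_ball2 z : is_proj ball2 z ((scale2 z)^-1 *: z).
Proof.
have [z1|z1] := lerP (dot z z) 1.
  rewrite /scale2 max_l // sqrtr1 invr1 scale1r; split=> // c _.
  by rewrite subrr dot0l.
have s0 := lt0r_neq0 (scale2_gt0 z).
rewrite -[X in is_proj _ X _](scale1r z) -[X in X *: z](divff s0) -scalerA.
apply: is_proj_ray (scale2_ge1 z).
rewrite dotZl dotZr mulrA -expr2 exprVn scale2_sqr max_r ?(ltW z1) //.
by rewrite mulVf // gt_eqF // (lt_trans ltr01).
Qed.

Context (P : 'cV[R]_m -> 'cV[R]_m) (projP : forall x, is_proj ball2 x (P x)).

Lemma proj_ball2E z : P z = (scale2 z)^-1 *: z.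
Proof. exact: is_proj_uniq (projP z) (is_proj_ball2 z). Qed.

(** By Pythagoras an orthogonal displacement changes the squared norm only by [dot w w], so the
    scaling factor moves to second order. *)
Lemma scale2_orth z w : dot w z = 0 ->
  `|(scale2 (z + w))^-1 - (scale2 z)^-1| <= dot w w.
Proof.
move=> wz; have zw : dot (z + w) (z + w) = dot z z + dot w w.
  by rewrite !dot_linE (dotC z w) wz; ring.
have := scale2_ge1 (z + w); have := scale2_ge1 z.
have := scale2_sqr (z + w); have := scale2_sqr z; rewrite zw.
have := dot_ge0 w; move: (scale2 _) (scale2 _) (dot z z) (dot w w).
move=> s' s r e e0 sE s'E s1 s'1.
have s0 : 0 < s by lra.
have s'0 : 0 < s' by lra.
have ss' : s ^+ 2 <= s' ^+ 2 <= s ^+ 2 + e.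
  rewrite sE s'E; have [r1|r1] := lerP 1 r.
    by rewrite !max_r ?lexx ?andbT //; lra.
  rewrite le_max lexx ge_max /=; apply/andP; split; lra.
have /andP[ss'1 ss'2] := ss'.
have sls' : s <= s' by rewrite -(@ler_pXn2r _ 2) // ?nnegrE ltW.
have -> : s'^-1 - s^-1 = - ((s' - s) / (s * s')) by field; rewrite !gt_eqF.
rewrite normrN ger0_norm; last by rewrite divr_ge0 ?subr_ge0 // mulr_ge0 // ltW.
(* Since [s] and [s'] are at least 1, [s' - s <= s' ^+ 2 - s ^+ 2 <= e <= e * (s * s')]. *)
rewrite ler_pdivrMr ?mulr_gt0 //; apply: (@le_trans _ _ e).
  have h1 : 0 <= (s' - s) * (s' + s - 1) by rewrite mulr_ge0 //; lra.
  by lra.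
by rewrite ler_peMr //; apply: mulr_ege1.
Qed.

(** The quotient is [(delta h + (scale2 z)^-1) *: w + (h^-1 * delta h) *: z] with [delta] of order
    [h ^+ 2]. The limit exists even on the unit sphere, where [P] is not differentiable. *)
Lemma proj_ball2_quotient z w : dot w z = 0 ->
  h^-1 *: (P (h *: w + z) - P z) @[h --> (0 : R)^'] --> (scale2 z)^-1 *: w.
Proof.
move=> wz; pose delta h := (scale2 (z + h *: w))^-1 - (scale2 z)^-1.
have delta_le h : `|delta h| <= h * h * dot w w.
  apply: le_trans (scale2_orth _) _; first by rewrite dotZl wz mulr0.
  by rewrite dotZl dotZr; lra.
have h0 : h @[h --> (0 : R)^'] --> (0 : R) by exact: cvg_within.
have d0 : delta h @[h --> (0 : R)^'] --> (0 : R).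
  apply/norm_cvg0P; apply: (squeeze_cvgr (f := fun=> 0)
    (h := fun h => h * h * dot w w)).
  - by apply: nearW => h; rewrite normr_ge0 delta_le.
  - exact: cvg_cst.
  - rewrite -[X in _ --> X](_ : 0 * 0 * dot w w = 0); last by rewrite !mul0r.
    by apply: cvgM; [exact: cvgM|exact: cvg_cst].
have hd0 : h^-1 * delta h @[h --> (0 : R)^'] --> (0 : R).
  apply/norm_cvg0P; apply: (squeeze_cvgr (f := fun=> 0)
    (h := fun h => `|h| * dot w w)).
  - near=> h; have hn0 : h != 0 by near: h; exact: nbhs_dnbhs_neq.
    rewrite normr_ge0 normrM normfV ler_pdivrMl ?normr_gt0 //.
    by rewrite mulrA -expr2 real_normK ?num_real // expr2 delta_le.
  - exact: cvg_cst.
  - rewrite -[X in _ --> X](_ : `|0 : R| * dot w w = 0); last first.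
      by rewrite normr0 mul0r.
    by apply: cvgM; [exact: cvg_norm|exact: cvg_cst].
rewrite -[X in _ --> X]addr0 -[X in _ + X](scale0r z).
rewrite -[X in X *: w + _]add0r.
apply: (@cvg_trans _ ((delta h + (scale2 z)^-1) *: w + (h^-1 * delta h) *: z
    @[h --> (0 : R)^'])); last first.
  apply: cvgD; apply: cvgZr_tmp => //.
  by apply: cvgD => //; exact: cvg_cst.
apply: near_eq_cvg; near=> h.
have hn0 : h != 0 by near: h; exact: nbhs_dnbhs_neq.
rewrite !proj_ball2E /delta (addrC (h *: w)) subrK.
move: (scale2 _)^-1 (scale2 _)^-1 => s s'.
by apply/matrixP => i j; rewrite !mxE; field.
Unshelve. all: by end_near. Qed.

End EuclideanBall.

(** * Euclidean ball: interior case and tangent spaces of the sphere *)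

Section EuclideanBallJacobian.
Context {R : realType} {m : nat}.
Implicit Types (v w x z c : 'cV[R]_m).
Context (P : 'cV[R]_m -> 'cV[R]_m) (projP : forall x, is_proj ball2 x (P x)).

Lemma limiting_const x J : (\forall y \near x, differentiable P y /\
    jacobian_cV P y = J) ->
  limiting_jacobian P x J /\ forall V, clarke_jacobian P x V -> V = J.
Proof.
move=> nJ; split.
  have [dx Jx] := nbhs_singleton nJ; exists (fun=> x); split=> //.
    exact: cvg_cst.
  by rewrite Jx; exact: cvg_cst.
move=> V [k [a [Js [_ a1 limJs ->]]]].
rewrite -[RHS]scale1r -a1 scaler_suml; apply: eq_bigr => i _; congr (_ *: _).
have [z [_ zx zJ]] := limJs i.
suff zJ' : jacobian_cV P (z k') @[k' --> \oo] --> J by apply: cvg_unique zJ zJ'.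
apply: cvg_near_cst.
have : \forall k' \near \oo, differentiable P (z k') /\
  jacobian_cV P (z k') = J := zx _ nJ.
by apply: filterS => k' [].
Qed.

Lemma clarke_spans_ball2_interior x : dot (P x) (P x) < 1 ->
  clarke_spans P x (lineality (tangent_cone ball2 (P x))).
Proof.
move=> v1.
have Pid y : dot y y < 1 -> P y = y.
  move=> y1; rewrite (proj_ball2E projP) /scale2 max_l ?ltW // sqrtr1 invr1.
  exact: scale1r.
(* Otherwise [P x] would have norm 1. *)
have x1 : dot x x < 1.
  rewrite ltNge; apply/negP => x1; move: v1.
  rewrite (proj_ball2E projP) dotZl dotZr mulrA -expr2 exprVn scale2_sqr max_r // mulVf ?ltxx //.
  by rewrite gt_eqF // (lt_le_trans ltr01).
have nx : \forall y \near x, dot y y < 1.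
  have xx : dot y y @[y --> x] --> dot x x.
    by apply: (cvg_dot (FF := nbhs_filter x)); exact: cvg_id.
  exact: (@cvgr_lt _ _ _ (nbhs_filter x) _ _ xx _ x1).
have nJ : \forall y \near x, differentiable P y /\ jacobian_cV P y = 1%:M.
  have := near_join nx; apply: filterS => y ny.
  apply: (near_affine_jacobian (c := 0)); move: ny; apply: filterS => y' y'1.
  by rewrite add0r mul1mx Pid.
have T d : tangent_cone ball2 (P x) d.
  apply: tangent_cone_dir; rewrite Pid //.
  have xtd : x + t *: d @[t --> (0 : R)] --> x by apply: cvg_line; exact: cvg_id.
  have : \forall t \near (0 : R), dot (x + t *: d) (x + t *: d) < 1 := xtd _ nx.
  by apply: filterS => t /ltW.
have [limJ clJ] := limiting_const nJ; split.
- by move=> V; exact: clarke_proj_firm.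
- by move=> V w /clJ -> _; exists 1; rewrite ?ltr01 // mul1mx scale1r.
- by exists 1%:M; [exact: limiting_clarke|move=> w; split; exact: T].
Qed.

(** For [w] orthogonal to [v], the points [v + t *: w] may leave the ball, so they are projected
    back; [proj_ball2_quotient] shows that the projected curve still has velocity [w] at [v]. *)
Lemma lineality_ball2 v : dot v v = 1 ->
  lineality (tangent_cone ball2 v) = [set w | dot v w = 0].
Proof.
move=> v1; have vS : ball2 v by rewrite /ball2 /= v1.
have nv c : ball2 c -> dot v (c - v) <= 0.
  by move=> cS; rewrite dotDr dotNr v1 subr_le0 dot_ball2_le1.
have Pv : P v = v.
  by apply: is_proj_uniq (projP v) _; rewrite -{1}(scale1r v); exact: is_proj_ray.
have Tdir w : dot v w = 0 -> tangent_cone ball2 v w.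
  rewrite dotC => wv.
  have h0 : (@harmonic R) @ \oo --> (0 : R)^'.
    move=> A; rewrite /= -[X in X -> _]/(\forall h \near (0 : R), h != 0 -> A h) => nA.
    have : \forall k \near \oo, harmonic k != 0 -> A (harmonic k) :=
      @cvg_harmonic R _ nA.
    by apply: filterS => k; apply; rewrite gt_eqF // harmonic_gt0.
  exists harmonic, (fun k => P (harmonic k *: w + v)); split.
  - exact: harmonic_gt0.
  - exact: cvg_harmonic.
  - by move=> k; have [] := projP (harmonic k *: w + v).
  - have hv : harmonic k *: w + v @[k --> \oo] --> v.
      by under eq_cvg do rewrite addrC; apply: cvg_line; exact: cvg_harmonic.
    by have := cvg_comp _ P hv (proj_cvg (x := v) projP); rewrite Pv.
  - have := cvg_comp _ _ h0 (proj_ball2_quotient projP wv).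
    by rewrite Pv /scale2 v1 maxxx sqrtr1 invr1 scale1r.
apply/seteqP; split=> [w [Tw TNw]|w /= vw].
  have := tangent_cone_dot_le0 nv Tw; have := tangent_cone_dot_le0 nv TNw.
  by rewrite dotNr oppr_le0 => *; apply/le_anti/andP.
by split; apply: Tdir; rewrite ?dotNr vw ?oppr0.
Qed.

End EuclideanBallJacobian.

(** * Euclidean ball: projections on the sphere *)

Section EuclideanBallBoundary.
Context {R : realType} {m : nat}.
Implicit Types (w z c : 'cV[R]_m).
Context (P : 'cV[R]_m -> 'cV[R]_m) (projP : forall x, is_proj ball2 x (P x)).
Context (x : 'cV[R]_m) (v1 : dot (P x) (P x) = 1).
Local Notation v := (P x).
Local Notation r := (scale2 x).

Let xE : x = r *: v.
Proof.
by rewrite (proj_ball2E projP) scalerA mulfV ?scale1r // gt_eqF // scale2_gt0.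
Qed.

Let r_gt0 : 0 < r. Proof. exact: scale2_gt0. Qed.

Lemma limiting_ball2_eigen w J : dot v w = 0 -> limiting_jacobian P x J ->
  J *m w = r^-1 *: w.
Proof.
move=> vw [z [dz zx zJ]].
have zz : dot (z k) (z k) @[k --> \oo] --> dot x x by exact: cvg_dot.
have wz : dot w (z k) @[k --> \oo] --> dot w x.
  by apply: cvg_dot zx; exact: cvg_cst.
have Pz : P (z k) @[k --> \oo] --> v := cvg_comp _ P zx (proj_cvg (x := x) projP).
(* A multiple of the component of [w] orthogonal to [z k], free of division. *)
pose u k := dot (z k) (z k) *: w - dot w (z k) *: z k.
have ux : u k @[k --> \oo] --> dot x x *: w.
  rewrite -[X in _ --> X]subr0 -(scale0r x).
  have <- : dot w x = 0 by rewrite xE dotZr dotC vw mulr0.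
  apply: cvgB; first exact: cvgZr_tmp.
  exact: cvgZ.
(* The eigenvalue [(scale2 (z k))^-1] is expressed as [dot (P (z k)) (z k) / dot (z k) (z k)] with
   the denominator cleared, so the limit needs only continuity of [P]. *)
have Ju k : dot (z k) (z k) *: (jacobian_cV P (z k) *m u k) =
    dot (P (z k)) (z k) *: u k.
  have uz : dot (u k) (z k) = 0 by rewrite /u !dot_linE mulrC subrr.
  rewrite (jacobian_cV_dir (dz k) (proj_ball2_quotient projP uz)).
  by rewrite (proj_ball2E projP) dotZl scalerA mulrC.
have lhs : dot (z k) (z k) *: (jacobian_cV P (z k) *m u k) @[k --> \oo] -->
    dot x x *: (J *m (dot x x *: w)).
  by apply: cvgZ zz _; exact: cvg_mulmx.
have rhs : dot (z k) (z k) *: (jacobian_cV P (z k) *m u k) @[k --> \oo] -->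
    dot v x *: (dot x x *: w).
  by under eq_cvg do rewrite Ju; apply: cvgZ ux; exact: cvg_dot.
have xx : dot x x = r ^+ 2 by rewrite xE dotZl dotZr -xE v1 mulr1.
have vx : dot v x = r by rewrite {2}xE dotZr v1 mulr1.
have : dot x x *: (J *m (dot x x *: w)) = dot v x *: (dot x x *: w).
  by move: lhs rhs; exact: cvg_unique.
rewrite vx xx -scalemxAr !scalerA =>
  /(congr1 (fun y => (r ^+ 2 * r ^+ 2)^-1 *: y)).
rewrite !scalerA mulVf ?scale1r => [->|].
  by congr (_ *: _); field; rewrite gt_eqF.
by rewrite mulf_neq0 // expf_neq0 // gt_eqF.
Qed.

Lemma ball2_limiting_jacobian :
  exists2 M, limiting_jacobian P x M & forall w, dot v (M *m w) = 0.
Proof.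
(* The point [x] is approached along its ray from outside: when [r = 1], [P] is not differentiable
   at [x], while [s k > 1] for every [k]. *)
pose s k : R := r + harmonic k.
have s1 k : 1 < s k.
  have := @harmonic_gt0 R k; have := scale2_ge1 x.
  by rewrite /s; move: (harmonic k) => h; lra.
have s0 k : s k != 0 by rewrite gt_eqF // (lt_trans ltr01).
pose N : 'M[R]_m := 1%:M - v *m v^T.
have NE w : N *m w = w - dot v w *: v.
  rewrite mulmxBl mul1mx -mulmxA [v^T *m w]mx11_scalar -dotE.
  by rewrite mul_mx_scalar.
have zz k : dot (s k *: v) (s k *: v) = s k ^+ 2.
  by rewrite dotZl dotZr v1 mulr1.
have dP k : differentiable P (s k *: v).
  have near_gt1 : \forall z \near s k *: v, 1 < dot z z.
    have zz' : dot z z @[z --> s k *: v] --> s k ^+ 2.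
      by rewrite -zz; apply: (cvg_dot (FF := nbhs_filter (s k *: v))); exact: cvg_id.
    apply: (@cvgr_gt _ _ _ (nbhs_filter (s k *: v)) _ _ zz').
    by rewrite expr_gt1 // ltW // (lt_trans ltr01).
  apply: (@near_eq_differentiable _ _ _ (fun z => (Num.sqrt (dot z z))^-1 *: z)).
    move: near_gt1; apply: filterS => z /ltW z1.
    by rewrite (proj_ball2E projP) /scale2 max_r.
  have ddot : differentiable (fun z : 'cV[R]_m => dot z z) (s k *: v).
    rewrite (_ : (fun z => _) =
        \sum_i (fun z : 'cV[R]_m => z i 0) * (fun z => z i 0)).
      apply: differentiable_sum => i; apply: differentiableM;
        exact: differentiable_coord.
    by apply/funext => z; rewrite fct_sumE.
  have dsqrt : differentiable (fun z : 'cV[R]_m => Num.sqrt (dot z z)) (s k *: v).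
    apply: (@differentiable_comp _ _ _ _ (fun z => dot z z) Num.sqrt) => //.
    apply/derivable1_diffP; apply: ex_derive; apply: is_derive1_sqrt.
    by rewrite zz exprn_gt0 // (lt_trans ltr01).
  have dinv :
      differentiable (fun z : 'cV[R]_m => (Num.sqrt (dot z z))^-1) (s k *: v).
    apply: differentiableV => //.
    by rewrite zz sqrtr_sqr normr_eq0.
  rewrite (_ : (fun z => _) = \sum_i (fun z : 'cV[R]_m =>
      ((Num.sqrt (dot z z))^-1 * z i 0) *: (delta_mx i 0 : 'cV[R]_m))).
    apply: differentiable_sum => i; apply: differentiableZl.
    by apply: differentiableM => //; exact: differentiable_coord.
  apply/funext => z; rewrite fct_sumE.
  rewrite [X in _ *: X](_ : z = \sum_i z i 0 *: delta_mx i 0).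
    by rewrite scaler_sumr; apply: eq_bigr => i _; rewrite scalerA.
  by rewrite [LHS]matrix_sum_delta; apply: eq_bigr => j _; rewrite big_ord1.
(* Split [w] into a radial part, killed because [P] is constant on the ray, and an orthogonal part
   [N *m w], divided by [s k]. *)
have Jk k : jacobian_cV P (s k *: v) = (s k)^-1 *: N.
  apply: mulmx_cV_inj => w.
  have Jv : jacobian_cV P (s k *: v) *m v = 0.
    apply: jacobian_cV_affine_dir => //.
    have hs : h + s k @[h --> (0 : R)] --> s k.
      rewrite -[X in _ --> X]add0r; apply: cvgD; [exact: cvg_id|exact: cvg_cst].
    have : \forall h \near (0 : R), 1 < h + s k.
      exact: (@cvgr_gt _ _ _ (nbhs_filter (0 : R)) _ _ hs _ (s1 k)).
    apply: filterS => h /ltW h1; rewrite scaler0 addr0 -scalerDl.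
    rewrite (is_proj_uniq (projP _) (is_proj_ray v1 h1)).
    by rewrite (is_proj_uniq (projP _) (is_proj_ray v1 (ltW (s1 k)))).
  have Nw : dot (N *m w) (s k *: v) = 0.
    by rewrite NE dotZr !dot_linE v1 (dotC w v); ring.
  have := jacobian_cV_dir (dP k) (proj_ball2_quotient projP Nw).
  rewrite {1}NE mulmxBr -scalemxAr Jv scaler0 subr0 => ->.
  rewrite -scalemxAl /scale2 zz max_r ?sqrtr_sqr ?gtr0_norm ?(lt_trans ltr01) //.
  by rewrite expr_ge1 // ltW // (lt_trans ltr01).
exists (r^-1 *: N); last first.
  by move=> w; rewrite -scalemxAl NE !dot_linE v1 mulr1 subrr mulr0.
exists (fun k => s k *: v); have sr : s k @[k --> \oo] --> r.
  rewrite -[X in _ --> X]addr0; apply: cvgD; first exact: cvg_cst.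
  exact: cvg_harmonic.
split=> //; first by rewrite [X in _ --> X]xE; exact: cvgZr_tmp.
under eq_cvg do rewrite Jk; apply: cvgZr_tmp; apply: cvgV => //.
by rewrite gt_eqF.
Qed.

Lemma clarke_spans_ball2_boundary :
  clarke_spans P x (lineality (tangent_cone ball2 v)).
Proof.
rewrite (lineality_ball2 projP v1); split.
- by move=> V; exact: clarke_proj_firm.
- move=> V w cV vw; exists r^-1; first by rewrite invr_gt0.
  by apply: clarke_jacobian_eigen cV => J; exact: limiting_ball2_eigen.
- have [M limM vM] := ball2_limiting_jacobian.
  by exists M => //; exact: limiting_clarke.
Qed.

End EuclideanBallBoundary.

Lemma clarke_spans_ball2 (R : realType) m (P : 'cV[R]_m -> 'cV[R]_m) x :
  (forall x, is_proj ball2 x (P x)) ->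
  clarke_spans P x (lineality (tangent_cone ball2 (P x))).
Proof.
move=> projP; have [v1] := projP x; rewrite /ball2 /= le_eqVlt in v1.
by case/orP: v1 => [/eqP|] v1 _;
  [exact: clarke_spans_ball2_boundary|exact: clarke_spans_ball2_interior].
Qed.

(** * Conjugates that are indicators, and normals as subgradients *)

Section Conjugates.
Context {R : realType} {m : nat}.
Implicit Types (S : set 'cV[R]_m) (u v x s : 'cV[R]_m).

Lemma conjugate_eq_indic (f : 'cV[R]_m -> \bar R) S :
  (forall u, S u -> forall x, ((dot u x)%:E - f x <= 0)%E) -> f 0 = 0%E ->
  (forall u, ~ S u -> forall r : R, exists x, (r%:E <= (dot u x)%:E - f x)%E) ->
  conjugate f = indic_fun S.
Proof.
move=> fS f0 fNS; apply/funext => u; rewrite /conjugate /indic_fun.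
case: asboolP => [Su|NSu].
  apply/le_anti/andP; split.
    by apply: ge_ereal_sup => _ [x _ <-]; exact: fS.
  by apply: ereal_sup_ubound; exists 0 => //; rewrite f0 dot0r sube0.
apply: eq_infty => r; have [x rx] := fNS _ NSu r.
by apply: le_trans rx _; apply: ereal_sup_ubound; exists x.
Qed.

Lemma subdiff_indic_proj S u s (t : R) : S !=set0 -> 0 < t ->
  subdiff (indic_fun S) u s -> is_proj S (t *: s + u) u.
Proof.
move=> [c0 Sc0] t0 su.
(* If [u] were outside [S], the subgradient inequality at [c0] would bound [+oo] by 0. *)
have Su : S u.
  have := su c0; rewrite /indic_fun; case: asboolP => // _; case: asboolP => //.
split=> // c Sc; rewrite addrK dotZl pmulr_rle0 //.
have := su c; rewrite /indic_fun; case: asboolP => // _; case: asboolP => // _.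
by rewrite add0e lee_fin.
Qed.

(** The subgradient [s] is a normal at [u], so [t *: s + u] projects back to [u]; the tangent cone
    at the projection is thus the one at the multiplier. *)
Lemma prox_indic_spans S (f : 'cV[R]_m -> \bar R) (t : R) u s :
  f = indic_fun S -> closed S -> convex_set_cV S -> S !=set0 ->
  (forall P, (forall x, is_proj S x (P x)) ->
     forall x, clarke_spans P x (lineality (tangent_cone S (P x)))) ->
  0 < t -> subdiff f u s ->
  clarke_spans (prox t f) (t *: s + u) (lineality (tangent_cone S u)).
Proof.
move=> -> Scl Scvx S0 Sspan t0 su.
have projP x := prox_indic x t0 Scl Scvx S0.
have uE := is_proj_uniq (projP (t *: s + u)) (subdiff_indic_proj S0 t0 su).
by have := Sspan _ projP (t *: s + u); rewrite uE.
Qed.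

Context (q : 'cV[R]_m -> R) (q_ge0 : forall x, 0 <= q x).
Context (qZ : forall t x, q (t *: x) = `|t| * q x).
Context (q_coord : forall x i, `|x i 0| <= q x).

(** The real [sup] is a true supremum only on a nonempty set bounded above; 0 gives the former, and
    [q_coord] gives the bound by the sum of the [|v i 0|]. *)
Lemma dual_norm_le1 v :
  (dual_norm q v <= 1) <-> (forall x, q x <= 1 -> dot v x <= 1).
Proof.
have q0 : q 0 = 0 by rewrite -(scale0r (0 : 'cV[R]_m)) qZ normr0 mul0r.
split=> [v1 x qx|v1].
  apply: le_trans v1; apply: sup_upper_bound; last by exists x.
  split; first by exists (dot v 0), 0 => //=; rewrite q0 ler01.
  exists (\sum_i `|v i 0|) => _ [z qz <-]; apply: ler_sum => i _.
  apply: le_trans (ler_norm _) _; rewrite normrM ler_piMr //.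
  exact: le_trans (q_coord _ _) qz.
apply: ge_sup => [|_ [x qx <-]]; last exact: v1.
by exists (dot v 0), 0 => //=; rewrite q0 ler01.
Qed.

Lemma conjugate_norm :
  conjugate (EFin \o q) = indic_fun [set v | dual_norm q v <= 1].
Proof.
have q0 : q 0 = 0 by rewrite -(scale0r (0 : 'cV[R]_m)) qZ normr0 mul0r.
apply: conjugate_eq_indic => [u /dual_norm_le1 u1 x||u Nu r].
- rewrite /= -EFinB lee_fin subr_le0.
  have [qx0|qx_neq0] := eqVneq (q x) 0.
    rewrite qx0 (_ : x = 0) ?dot0r //; apply/matrixP => i j; rewrite ord1 mxE.
    by apply/eqP; rewrite -normr_le0 -qx0 q_coord.
  have qx_gt0 : 0 < q x by rewrite lt_def qx_neq0 q_ge0.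
  have := u1 ((q x)^-1 *: x); rewrite qZ gtr0_norm ?invr_gt0 // mulVf // lexx.
  by rewrite dotZr ler_pdivrMl // mulr1; exact.
- by rewrite /= q0.
- have [x [qx ux]] : exists x, q x <= 1 /\ 1 < dot u x.
    apply: contrapT => Nx; apply: Nu; apply/dual_norm_le1 => x qx.
    by rewrite leNgt; apply/negP => ux; apply: Nx; exists x.
  (* As [q x <= 1], the value at [t *: x] is at least [t * (dot u x - 1)], which is [|r|] for this
     [t]. *)
  pose t := `|r| / (dot u x - 1).
  have t_ge0 : 0 <= t by rewrite divr_ge0 // subr_ge0 ltW.
  exists (t *: x); rewrite /= -EFinB lee_fin qZ dotZr ger0_norm // -mulrBr.
  apply: le_trans (ler_norm r) _; apply: (@le_trans _ _ (t * (dot u x - 1))).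
    by rewrite divfK // gt_eqF // subr_gt0.
  by rewrite ler_wpM2l // lerB.
Qed.

End Conjugates.

(** * The three norms and their dual unit balls *)

Section Norms.
Context {R : realType} {m : nat}.
Implicit Types (v x : 'cV[R]_m).

Lemma norm_infP x (t : R) : 0 <= t ->
  reflect (forall i, `|x i 0| <= t) (norm_inf x <= t).
Proof.
move=> t0; rewrite /norm_inf [X in X <= _]/Num.norm /= mx_normrE.
apply: (iffP idP) => [/bigmax_leP[_ xt] i|xt]; first exact: (xt (i, 0)).
by apply/bigmax_leP; split=> // -[i j] _; rewrite /= ord1.
Qed.

(** The coordinate bound provides both definiteness of [q] and boundedness of its unit ball. *)
Definition is_norm_cV (q : 'cV[R]_m -> R) :=
  [/\ forall x, 0 <= q x, forall t x, q (t *: x) = `|t| * q x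
    & forall x i, `|x i 0| <= q x].

Lemma is_norm_norm1 : is_norm_cV norm1.
Proof.
split=> [x|t x|x i]; first exact: sumr_ge0.
  by rewrite /norm1 mulr_sumr; apply: eq_bigr => i _; rewrite mxE normrM.
by rewrite /norm1 (bigD1 i) //= lerDl sumr_ge0.
Qed.

Lemma is_norm_norm2 : is_norm_cV norm2.
Proof.
split=> [x|t x|x i]; first exact: norm2_ge0.
  by rewrite !norm2E dotZl dotZr mulrA -expr2 sqrtrM ?sqr_ge0 // sqrtr_sqr.
by rewrite norm2E -sqrtr_sqr ler_wsqrtr // sqr_coord_le_dot.
Qed.

Lemma is_norm_norm_inf : is_norm_cV norm_inf.
Proof.
split=> [x|t x|x i]; first exact: normr_ge0.
  exact: normrZ.
by have /(_ i) := norm_infP x (normr_ge0 x) (lexx _).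
Qed.

(** The rows are plus and minus the unit vectors: with right-hand side 1 they cut out the cube. *)
Definition box_mx : 'M[R]_(m + m, m) := col_mx 1%:M (- 1%:M).

(** The rows are all sign vectors, one per facet of the cross-polytope when the right-hand side is
    1. *)
Definition sign_mx : 'M[R]_(#|{ffun 'I_m -> bool}|, m) :=
  \matrix_(j, i) (-1) ^+ (enum_val j : {ffun 'I_m -> bool}) i.

Lemma dual_ball_norm1 :
  [set v | dual_norm norm1 v <= 1] = polyhedron box_mx (const_mx 1).
Proof.
have [q0 qZ qc] := is_norm_norm1; apply/seteqP; split=> v /=.
  move=> /(dual_norm_le1 qZ qc) v1 j; rewrite mul_col_mx mulNmx mul1mx.
  have e1 i : norm1 (delta_mx i 0 : 'cV[R]_m) = 1.
    rewrite /norm1 (bigD1 i) //= mxE !eqxx normr1 big1 ?addr0 // => k ki.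
    by rewrite mxE (negbTE ki) normr0.
  have dv i : dot v (delta_mx i 0) = v i 0 by rewrite dotE -colE !mxE.
  rewrite [leRHS]mxE; case: (split_ordP j) => i ->.
    by rewrite col_mxEu -dv v1 // e1.
  by rewrite col_mxEd mxE -dv -dotNr v1 // -scaleN1r qZ normrN1 mul1r e1.
move=> vbox; apply/(dual_norm_le1 qZ qc) => x; apply: le_trans.
apply: ler_sum => i _; apply: le_trans (ler_norm _) _.
rewrite normrM ler_piMl // ler_norml.
have := vbox (lshift m i); have := vbox (rshift m i).
rewrite mul_col_mx mulNmx mul1mx col_mxEu col_mxEd !mxE => vi vi'.
by rewrite vi' andbT lerNl.
Qed.

Lemma dual_ball_norm2 : [set v | dual_norm norm2 v <= 1] = ball2 :> set 'cV[R]_m.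
Proof.
have [q0 qZ qc] := is_norm_norm2; apply/seteqP; split=> v /=.
  move=> /(dual_norm_le1 qZ qc) v1; rewrite /ball2 /= -norm2_le1.
  have [-> //|nv0] := eqVneq (norm2 v) 0.
  have nv : 0 < norm2 v by rewrite lt_def nv0 norm2_ge0.
  have := v1 ((norm2 v)^-1 *: v); rewrite qZ gtr0_norm ?invr_gt0 // mulVf // lexx.
  by rewrite dotZr -norm2_sqr expr2 mulKf //; exact.
move=> v1; apply/(dual_norm_le1 qZ qc) => x; rewrite norm2_le1 => x1.
exact: dot_ball2_le1.
Qed.

Lemma dual_ball_norm_inf :
  [set v | dual_norm norm_inf v <= 1] = polyhedron sign_mx (const_mx 1).
Proof.
have [q0 qZ qc] := is_norm_norm_inf; apply/seteqP; split=> v /=.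
  move=> /(dual_norm_le1 qZ qc) v1 j; rewrite [leRHS]mxE.
  have -> : (sign_mx *m v) j 0 = dot v (row j sign_mx)^T.
    by rewrite dotC dotE trmxK -row_mul [RHS]mxE.
  by apply: v1; apply/norm_infP => // i; rewrite !mxE normrX normrN1 expr1n.
move=> vs; apply/(dual_norm_le1 qZ qc) => x x1.
(* The row with the signs of [v] evaluates to the sum of the [|v i 0|], which bounds [dot v x] on
   the unit ball of the maximum norm. *)
pose s : {ffun 'I_m -> bool} := [ffun i => v i 0 < 0].
have := vs (enum_rank s); rewrite [leRHS]mxE; apply: le_trans.
rewrite mxE; apply: ler_sum => i _; rewrite mxE enum_rankK ffunE.
apply: le_trans (ler_norm _) _; rewrite normrM.
apply: (@le_trans _ _ `|v i 0|).
  by rewrite ler_piMr //; apply/(norm_infP x ler01).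
case: ltrP => vi; first by rewrite expr1 mulN1r ltr0_norm.
by rewrite expr0 mul1r ger0_norm.
Qed.

End Norms.

(** * Application to the multipliers [u] and [v], and conclusion *)

Lemma C1_polyhedron (R : realType) n :
  @C1 R n = polyhedron (- 1%:M) 0.
Proof.
apply/seteqP; split=> u uC j; have := uC j.
  by rewrite mulNmx mul1mx !mxE oppr_le0.
by rewrite mulNmx mul1mx !mxE oppr_le0.
Qed.

Lemma hstar_indic (R : realType) n : @hstar R n = indic_fun C1.
Proof.
apply: conjugate_eq_indic => [u u0 x||u Nu r].
- rewrite /hfun /indic_fun; case: asboolP => [x0|_]; last by rewrite addeNy.
  rewrite sube0 lee_fin; apply: sumr_le0 => i _.
  by rewrite mulr_ge0_le0 ?u0 // x0.
- by rewrite /hfun /indic_fun; case: asboolP => // -[] i; rewrite mxE.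
- have [i ui] : exists i, u i 0 < 0.
    apply: contrapT => Ni; apply: Nu => i; rewrite leNgt; apply/negP => ui.
    by apply: Ni; exists i.
  (* As [u i 0 < 0], this [t] is nonpositive, so [t *: delta_mx i 0] is feasible for [hfun], and its
     product with [u] is [|r|]. *)
  pose t := `|r| / u i 0; exists (t *: delta_mx i 0).
  have t0 : t <= 0 by rewrite mulr_ge0_le0 // invr_le0 ltW.
  rewrite /hfun /indic_fun; case: asboolP => [_|[] j]; last first.
    by rewrite !mxE mulr_le0_ge0.
  rewrite sube0 lee_fin dotZr dotE -colE !mxE divfK ?lt_eqF //.
  exact: ler_norm.
Qed.

Lemma orthant_spans (R : realType) n (t : R) (u s : 'cV[R]_(dim2 n)) : 0 < t ->
  subdiff hstar u s ->
  clarke_spans (prox t hstar) (t *: s + u) (lineality (tangent_cone C1 u)).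
Proof.
apply: prox_indic_spans; first exact: hstar_indic.
- by rewrite C1_polyhedron; exact: closed_polyhedron.
- by rewrite C1_polyhedron; exact: convex_polyhedron.
- by exists 0 => i; rewrite mxE.
- by rewrite C1_polyhedron => P projP x; exact: clarke_spans_polyhedron.
Qed.

Lemma dual_ball_spans (R : realType) n (q : 'cV[R]_(dim1 n) -> R) (t : R)
    (v s : 'cV[R]_(dim1 n)) :
  [\/ q = norm1, q = norm2 | q = norm_inf] -> 0 < t ->
  subdiff (qstar q) v s ->
  clarke_spans (prox t (qstar q)) (t *: s + v)
    (lineality (tangent_cone (C2 q) v)).
Proof.
move=> q_norm.
have [q0 qZ qc] : is_norm_cV q.
  by case: q_norm => ->;
    [exact: is_norm_norm1|exact: is_norm_norm2|exact: is_norm_norm_inf].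
apply: prox_indic_spans; first exact: conjugate_norm.
- rewrite /C2; case: q_norm => ->.
  + by rewrite dual_ball_norm1; exact: closed_polyhedron.
  + by rewrite dual_ball_norm2; exact: closed_ball2.
  + by rewrite dual_ball_norm_inf; exact: closed_polyhedron.
- rewrite /C2; case: q_norm => ->.
  + by rewrite dual_ball_norm1; exact: convex_polyhedron.
  + by rewrite dual_ball_norm2; exact: convex_ball2.
  + by rewrite dual_ball_norm_inf; exact: convex_polyhedron.
- exists 0; apply/(dual_norm_le1 qZ qc) => x _.
  by rewrite dot0l ler01.
- rewrite /C2; case: q_norm => -> P.
  + by rewrite dual_ball_norm1 => projP x; exact: clarke_spans_polyhedron.
  + by rewrite dual_ball_norm2 => projP x; exact: clarke_spans_ball2.
  + by rewrite dual_ball_norm_inf => projP x; exact: clarke_spans_polyhedron.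
Qed.

Theorem theorem4p1 (R : realType) (n : nat) (n_ge3 : (3 <= n)%N)
    (Xt : 'M[R]_n) (Xt_sym : Xt^T = Xt)
    (Xt_ge0 : forall i j : 'I_n, 0 <= Xt i j)
    (Xt_diag : forall i : 'I_n, Xt i i = 0)
    (W : 'M[R]_n) (W_sym : W^T = W)
    (D_gt0 : forall c : 'I_(dim1 n), 0 < weight_mx W c c)
    (q : 'cV[R]_(dim1 n) -> R)
    (q_norm : [\/ q = norm1, q = norm2 | q = norm_inf])
    (sigma : R) (sigma_gt0 : 0 < sigma)
    (y : 'cV[R]_(dim1 n)) (u : 'cV[R]_(dim2 n)) (v : 'cV[R]_(dim1 n))
    (yuv_KKT : KKT q Xt W y u v) :
  dual_nondegenerate q W u v <->
  (forall M : 'M[R]_(dim1 n), gen_hessian q sigma Xt W y u v M ->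
    M \in unitmx).
Proof.
have [_ su sv] := yuv_KKT.
exact: spans_iff_nonsingular sigma_gt0 (orthant_spans sigma_gt0 su)
  (dual_ball_spans q_norm sigma_gt0 sv).
Qed.
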